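(* Fix $n\ge2$ and $0<\theta<\pi$. There exist a smooth one-ended rotational support $S_\rho\subset\mathbb R^{n+1}$ without cylindrical intervals and a compact embedded minimal $\theta$-capillary hypersurface $\Sigma$ supported on $S_\rho$ such that: - $D_0\subset W_\Sigma$; - the slope condition ''for all $0<a<b<L$, $\rho'(a)>-\cot\theta$ implies $\rho'(b)\ge-\cot\theta$'' fails; - $\Sigma$ is a nonhorizontal planar $n$-ball (an $n$-dimensional ball contained in a non-horizontal hyperplane). If $\theta\ne\pi/2$, the support can also be chosen so that $A_\theta(b)<B_\theta(a)$ for all $0<a<b<\ell_\theta$. (Thus, without the slope condition, a compact embedded minimal $\theta$-capillary hypersurface supported on $S_\rho$ need not be a horizontal slice, even when it is homologous to $D_0$ relative to $S_\rho$ and, for $\theta\neq\pi/2$, the inequality $A_\theta(b)<B_\theta(a)$ holds for all $0<a<b<\ell_\theta$.)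
   Context: Write points of $\mathbb R^{n+1}$ as $(y,z)$, $y\in\mathbb R^n$, $z\in\mathbb R$. A smooth one-ended rotational support is given by $0<L\le\infty$ and a positive smooth function $\rho$ on $[0,L)$ whose meridian is proper and complete as $z\uparrow L$ (the curve $z\mapsto(\rho(z),z)$ leaves every compact set of $\mathbb R^2$ and has infinite length as $z\uparrow L$), through $$S_\rho=\{(\rho(z)\omega,z):\omega\in\mathbb S^{n-1},\ 0\le z<L\},\qquad M_\rho=\{(y,z):|y|\le\rho(z),\ 0\le z<L\},$$ $$D_h=\{(y,h):|y|\le\rho(h)\}\ (0\le h<L),\qquad N_{S_\rho}=\frac{(\omega,-\rho')}{\sqrt{1+\rho'^2}},\qquad \widehat S_\rho=D_0\cup S_\rho .$$ $N_{S_\rho}$ is the outward unit normal of $M_\rho$ along $S_\rho$; $\widehat S_\rho$ is homeomorphic to $\mathbb R^n$. ''Without cylindrical intervals'' means that $\rho'$ does not vanish identically on any nondegenerate interval. A horizontal slice is a set $D_h$ with $0<h<L$. A compact embedded minimal $\theta$-capillary hypersurface supported on $S_\rho$ is a smooth, compact, properly embedded hypersurface $\Sigma^n\subset\overline{M_\rho}$ with boundary, of zero mean curvature, each of whose components is two-sided, with $\Sigma\setminus\partial\Sigma\subset\operatorname{int}M_\rho$ and $\varnothing\ne\partial\Sigma\subset S_\rho\setminus\partial D_0$, such that each connected component $\Sigma_0$ satisfies the following contact condition. Let $W_{\Sigma_0}\subset\widehat S_\rho$ be the unique compact regular region with boundary $\partial\Sigma_0$ (the closure of the set of points lying in an odd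 number of the bounded regions of $\widehat S_\rho$ cut off by the components of $\partial\Sigma_0$), and let $\mu_{S_\rho}$ be the unit vector along $\partial\Sigma_0$ tangent to $S_\rho$, normal to $\partial\Sigma_0$ and pointing into $W_{\Sigma_0}$. Then $\Sigma_0$ has a smooth unit normal field $\nu_{\Sigma_0}$ with $\langle\nu_{\Sigma_0},N_{S_\rho}\rangle=-\cos\theta$ and $\nu_{\Sigma_0}=-\cos\theta\,N_{S_\rho}+\sin\theta\,\mu_{S_\rho}$ along $\partial\Sigma_0$. Homology is in $H_n(M_\rho,S_\rho;\mathbb Z_2)$; for connected $\Sigma$, $[\Sigma]=[D_0]$ iff $D_0\subset W_\Sigma$. For $\theta\ne\pi/2$: $\ell_\theta=\sup\{b\in[0,L):\rho'(b)<-\cot\theta\}$, with $\ell_\theta=0$ if this set is empty, and $$A_\theta=\frac{\rho^{n-1}(1+\tan\theta\,\rho')}{\sqrt{1+\rho'^2}},\qquad B_\theta=\frac{\rho^{n-1}(1-\tan\theta\,\rho')}{\sqrt{1+\rho'^2}}$$ as functions of the height $z\in[0,L)$. *)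

(* Defs.v *)
From HB Require Import structures.
From mathcomp Require Import all_boot all_order all_algebra.
From mathcomp Require Import all_classical all_reals all_analysis.

Set Implicit Arguments.
Unset Strict Implicit.
Unset Printing Implicit Defensive.

Import Order.TTheory GRing.Theory Num.Theory.
Import numFieldNormedType.Exports.

Local Open Scope classical_set_scope.
Local Open Scope ring_scope.

(* R^(n+1), with points (y, z). The library norms on 'rV[R]_n and on products
   are sup norms; they are used for the topology only, and the Euclidean
   structure is given by [dot] and [inner]. *)
Notation ambient R n := ('rV[R]_n * R)%type.

Definition dot (R : realType) (n : nat) (u v : 'rV[R]_n) : R :=
  \sum_(i < n) u 0 i * v 0 i.

Definition inner (R : realType) (n : nat) (p q : ambient R n) : R :=
  dot p.1 q.1 + p.2 * q.2.

Definition enorm (R : realType) (n : nat) (u : 'rV[R]_n) : R :=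
  Num.sqrt (dot u u).

Definition cot (R : realType) (x : R) : R := cos x / sin x.

(* iter_deriv [:: v1; ...; vk] f = D_v1 (... (D_vk f)) *)
Definition iter_deriv (R : realType) (V W : normedModType R) (vs : seq V)
    (f : V -> W) : V -> W :=
  foldr (fun v g => fun x => 'D_v g x) f vs.

(* C^oo on an open set U of a finite-dimensional space: every iterated
   directional derivative is (Frechet) differentiable at every point of U. *)
Definition smooth_on (R : realType) (V W : normedModType R) (U : set V)
    (f : V -> W) : Prop :=
  forall (vs : seq V) (x : V), U x -> differentiable (iter_deriv vs f) x.

(* Smoothness on an arbitrary subset: local smooth extendability. *)
Definition smooth_along (R : realType) (V W : normedModType R) (A : set V)
    (f : V -> W) : Prop :=
  forall p, A p -> exists (U : set V) (g : V -> W),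
    [/\ open U, U p, smooth_on U g & forall q, A q -> U q -> g q = f q].

(* v is the initial velocity of a curve issuing from p and staying in A for
   small nonnegative times. *)
Definition velocity (R : realType) (n : nat) (A : set (ambient R n))
    (p v : ambient R n) : Prop :=
  exists gamma : R -> ambient R n,
    [/\ gamma 0 = p, is_derive (0 : R) (1 : R) gamma v &
        exists2 e : R, 0 < e & forall t, 0 <= t < e -> A (gamma t)].

(* Tangent vectors of a submanifold with boundary; at a boundary point the
   initial velocities only fill the closed inner half of the tangent space. *)
Definition tangent (R : realType) (n : nat) (A : set (ambient R n))
    (p v : ambient R n) : Prop :=
  velocity A p v \/ velocity A p (- v).

Definition half_space (R : realType) (n : nat) (i : 'I_n) : set 'rV[R]_n :=
  [set u | 0 <= u 0 i].

(* X is a local parametrization: a smooth immersion which restricts to a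
   homeomorphism from the relatively open part O of a half-space of R^n onto
   S `&` U. Interior charts are those whose O lies inside the half-space. *)
Definition chart (R : realType) (n : nat) (S : set (ambient R n)) (i : 'I_n)
    (O : set 'rV[R]_n) (U : set (ambient R n)) (X : 'rV[R]_n -> ambient R n)
    : Prop :=
  [/\ open O /\ open U,
      smooth_on O X,
      forall u, O u -> half_space i u -> injective ('d X u),
      X @` (O `&` half_space i) = S `&` U &
      exists2 Y : ambient R n -> 'rV[R]_n,
        {within S `&` U, continuous Y} &
        forall u, O u -> half_space i u -> Y (X u) = u].

Definition hypersurface (R : realType) (n : nat) (S : set (ambient R n)) : Prop :=
  forall p, S p -> exists (i : 'I_n) (O : set 'rV[R]_n) (U : set (ambient R n))
    (X : 'rV[R]_n -> ambient R n), chart S i O U X /\ U p.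

Definition mboundary (R : realType) (n : nat) (S : set (ambient R n))
    : set (ambient R n) :=
  [set p | exists (i : 'I_n) (O : set 'rV[R]_n) (U : set (ambient R n))
    (X : 'rV[R]_n -> ambient R n) (u : 'rV[R]_n),
    [/\ chart S i O U X, O u, u 0 i = 0 & X u = p]].

Definition unit_normal (R : realType) (n : nat) (S A : set (ambient R n))
    (nu : ambient R n -> ambient R n) : Prop :=
  forall q, A q ->
    inner (nu q) (nu q) = 1 /\ forall v, tangent S q v -> inner (nu q) v = 0.

Definition two_sided (R : realType) (n : nat) (S : set (ambient R n)) : Prop :=
  exists2 nu : ambient R n -> ambient R n, smooth_along S nu & unit_normal S S nu.

(* If S has dimension n, such a frame is an orthonormal basis of T_p S. *)
Definition orthonormal_frame (R : realType) (n : nat) (S : set (ambient R n))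
    (p : ambient R n) (e : 'I_n -> ambient R n) : Prop :=
  (forall i, tangent S p (e i)) /\
  (forall i j, inner (e i) (e j) = (i == j)%:R).

(* The trace over the frame e of the differential of the unit normal nu, that
   is, the mean curvature up to sign and normalization. It does not depend on
   the frame nor on the extension of nu off S. *)
Definition mean_curvature (R : realType) (n : nat)
    (nu : ambient R n -> ambient R n) (p : ambient R n) (e : 'I_n -> ambient R n) : R :=
  \sum_(i < n) inner ('D_(e i) nu p) (e i).

Definition minimal (R : realType) (n : nat) (S : set (ambient R n)) : Prop :=
  forall p, S p -> exists (U : set (ambient R n)) (nu : ambient R n -> ambient R n),
    [/\ open U /\ U p, smooth_on U nu, unit_normal S (S `&` U) nu &
        forall e, orthonormal_frame S p e -> mean_curvature nu p e = 0].

Definition heights (R : realType) (L : \bar R) : set R :=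
  [set z | 0 <= z /\ (z%:E < L)%E].

(* Smoothness on [0, L[ means smoothness of an extension past 0; rho itself is
   taken to be that extension, so that [derive1 rho] is the one-sided derivative
   at 0. Values of rho outside [0, L[ are otherwise irrelevant. *)
Record rotational_support (R : realType) (L : \bar R) (rho : R -> R) : Prop := {
  support_height : (0 < L)%E ;
  support_smooth : exists2 e : R, 0 < e &
    smooth_on [set z : R | - e < z /\ (z%:E < L)%E] rho ;
  support_pos : forall z, heights L z -> 0 < rho z ;
  support_proper : forall K : set (R * R), compact K ->
    exists2 z0, heights L z0 & forall z, heights L z -> z0 <= z -> ~ K (rho z, z) ;
  support_complete :
    (\int[lebesgue_measure]_(z in heights L)
       (Num.sqrt (1 + (derive1 rho z) ^+ 2))%:E = +oo)%E }.

Definition no_cylindrical_interval (R : realType) (L : \bar R) (rho : R -> R)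
    : Prop :=
  forall a b, heights L a -> heights L b -> a < b ->
    ~ (forall z, a <= z <= b -> derive1 rho z = 0).

Definition S_ (R : realType) (n : nat) (L : \bar R) (rho : R -> R)
    : set (ambient R n) :=
  [set p | heights L p.2 /\
    exists2 omega : 'rV[R]_n, enorm omega = 1 & p.1 = rho p.2 *: omega].

Definition M_ (R : realType) (n : nat) (L : \bar R) (rho : R -> R)
    : set (ambient R n) :=
  [set p | heights L p.2 /\ enorm p.1 <= rho p.2].

Definition D_ (R : realType) (n : nat) (rho : R -> R) (h : R)
    : set (ambient R n) :=
  [set p | p.2 = h /\ enorm p.1 <= rho h].

Definition rim (R : realType) (n : nat) (rho : R -> R) (h : R)
    : set (ambient R n) :=
  [set p | p.2 = h /\ enorm p.1 = rho h].

Definition capped (R : realType) (n : nat) (L : \bar R) (rho : R -> R)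
    : set (ambient R n) :=
  D_ rho 0 `|` S_ L rho.

(* (omega, -rho') / sqrt (1 + rho'^2) at the point p = (rho(z) omega, z) *)
Definition N_ (R : realType) (n : nat) (rho : R -> R) (p : ambient R n)
    : ambient R n :=
  (Num.sqrt (1 + (derive1 rho p.2) ^+ 2))^-1 *:
    ((rho p.2)^-1 *: p.1, - derive1 rho p.2).

Definition components (T : topologicalType) (A : set T) : set (set T) :=
  [set C | exists2 p, A p & C = connected_component A p].

(* The bounded region of T cut off by G. When T is the capped support, T is
   closed in R^(n+1), hence "bounded" may be tested in R^(n+1). *)
Definition cut_off (R : realType) (n : nat) (T G : set (ambient R n))
    : set (ambient R n) :=
  [set x | (T `\` G) x /\ bounded_set (connected_component (T `\` G) x)].

(* The region W with boundary B: closure of the set of the points lying in an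
   odd number of the regions cut off by the components of B. *)
Definition region (R : realType) (n : nat) (T B : set (ambient R n))
    : set (ambient R n) :=
  closure [set x | T x /\ exists2 k : nat, odd k &
    ([set G | components B G /\ cut_off T G x] #= `I_k)%card].

Definition inner_conormal (R : realType) (n : nat) (T B W : set (ambient R n))
    (p mu : ambient R n) : Prop :=
  [/\ inner mu mu = 1,
      tangent T p mu,
      forall v, tangent B p v -> inner mu v = 0 &
      velocity W p mu].

Definition contact_condition (R : realType) (n : nat) (L : \bar R)
    (rho : R -> R) (theta : R) (Sigma0 : set (ambient R n)) : Prop :=
  exists nu : ambient R n -> ambient R n,
    [/\ smooth_along Sigma0 nu,
        unit_normal Sigma0 Sigma0 nu &
        forall p, mboundary Sigma0 p ->
          inner (nu p) (N_ rho p) = - cos theta /\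
          exists2 mu,
            inner_conormal (S_ L rho) (mboundary Sigma0)
              (region (capped L rho) (mboundary Sigma0)) p mu &
            nu p = - cos theta *: N_ rho p + sin theta *: mu].

Record minimal_capillary (R : realType) (n : nat) (L : \bar R) (rho : R -> R)
    (theta : R) (Sigma : set (ambient R n)) : Prop := {
  capillary_compact : compact Sigma ;
  capillary_hypersurface : hypersurface Sigma ;
  capillary_sub : Sigma `<=` closure (M_ L rho) ;
  capillary_minimal : minimal Sigma ;
  capillary_two_sided : forall Sigma0, components Sigma Sigma0 ->
    two_sided Sigma0 ;
  capillary_interior :
    Sigma `\` mboundary Sigma `<=` interior (M_ L rho) ;
  capillary_boundary_neq0 : mboundary Sigma !=set0 ;
  capillary_boundary_sub : mboundary Sigma `<=` S_ L rho `\` rim rho 0 ;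
  capillary_contact : forall Sigma0, components Sigma Sigma0 ->
    contact_condition L rho theta Sigma0 }.

Definition slope_condition (R : realType) (L : \bar R) (rho : R -> R)
    (theta : R) : Prop :=
  forall a b : R, 0 < a -> a < b -> (b%:E < L)%E ->
    - cot theta < derive1 rho a -> - cot theta <= derive1 rho b.

(* The closed n-ball with centre p0 and radius r in the hyperplane through p0
   orthogonal to v; this hyperplane is horizontal iff v.1 = 0. *)
Definition nonhorizontal_planar_ball (R : realType) (n : nat)
    (Sigma : set (ambient R n)) : Prop :=
  exists (p0 v : ambient R n) (r : R),
    [/\ v.1 != 0, 0 < r &
        Sigma = [set p | inner (p - p0) v = 0 /\
                         Num.sqrt (inner (p - p0) (p - p0)) <= r]].

Definition ell (R : realType) (L : \bar R) (rho : R -> R) (theta : R)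
    : \bar R :=
  let B := [set b | heights L b /\ derive1 rho b < - cot theta] in
  if `[< B = set0 >] then 0%E else ereal_sup (EFin @` B).

Definition A_ (R : realType) (n : nat) (rho : R -> R) (theta z : R) : R :=
  rho z ^+ n.-1 * (1 + tan theta * derive1 rho z) /
    Num.sqrt (1 + (derive1 rho z) ^+ 2).

Definition B_ (R : realType) (n : nat) (rho : R -> R) (theta z : R) : R :=
  rho z ^+ n.-1 * (1 - tan theta * derive1 rho z) /
    Num.sqrt (1 + (derive1 rho z) ^+ 2).

(* Main.v *)
Require Import Defs.
From HB Require Import structures.
From mathcomp Require Import all_boot all_order all_algebra.
From mathcomp Require Import all_classical all_reals all_analysis.
From mathcomp Require Import measurable_realfun ring lra.

Import Order.TTheory GRing.Theory Num.Theory.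
Import numFieldNormedType.Exports.

Set Implicit Arguments.
Unset Strict Implicit.
Unset Printing Implicit Defensive.

Local Open Scope classical_set_scope.
Local Open Scope ring_scope.

(** A plane at distance [cos theta] from the centre [c] of a unit sphere meets
    the sphere at the constant angle [theta], whatever its direction. So it
    suffices to find a support which contains a zone of such a sphere, centred
    on the axis, around the height where the slope of the meridian is
    [- cot theta]: a slightly tilted plane cuts a flat capillary disc out of
    this zone, and the slope condition fails there, since the slope of a circle
    decreases strictly across the value [- cot theta].

    Above the zone, of width [2 d], the circle is reparametrized by a bounded
    increasing function of the height and a linear term is added which pushes
    the slope above [- cot theta]. Hence the slope is within a small error of
    [- cot theta] at all heights below [ell], which makes
    [1 + tan theta * rho'] small and [1 - tan theta * rho'] close to 2; this
    gives [A_ b < B_ a].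

    The boundary of the disc is computed in both directions: an inversion of
    [R^n] exchanges the half-space with the unit ball minus a point of its
    sphere, and conversely every boundary point of a chart of the disc is the
    end of a segment in the plane of the disc which lies outside the disc. *)

(** * Smooth calculus *)

(** The support is defined at all heights, so properness and infinite length cost nothing; the price
    is that the meridian must stay positive and free of cylindrical intervals beyond the zone. This,
    together with the comparison of [A_] and [B_], dictates the final slope [M]. The zone is centred
    at height [d], where the circle has slope [- cot theta], and a tilt of sine [d / 8] keeps the
    disc between the heights [d / 2] and [3 * d / 2]. The obstacle is the region bounded by the rim,
    defined through connected components of the capped support. No component is computed: the part
    below the plane is the trace of an open set disjoint, on the support, from an open set covering
    the rest, so a component starting there cannot escape and is bounded. This needs a connected
    rim, and here [n >= 2] enters. The inner conormal is the velocity of the great circle leaving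
    the rim orthogonally; its height along the normal [v], measured from the centre of the sphere,
    is [cos (t + theta)], so it enters the region at once. *)

Lemma near_eq_differentiable (R : realType) (V W : normedModType R)
    (f g : V -> W) (x : V) :
  (\near x, f x = g x) -> differentiable f x -> differentiable g x.
Proof.
move=> fg df.
have fgx := nbhs_singleton fg.
(* [g] inherits the first-order expansion of [f]; uniqueness of the differential then turns ['d f x]
   into ['d g x]. *)
have H : g \o shift x = cst (g x) + 'd f x +o_ 0 id.
  apply/eqaddoP => e e0.
  have /eqaddoP/(_ e e0) := diff_locally df.
  rewrite (near_shift 0 x) subr0 in fg.
  by apply: filterS2 fg => h; rewrite /= !fctE /= -fgx => ->.
have cf : continuous ('d f x) by exact: diff_continuous.
have E := diff_unique cf H.
by apply/diff_locallyP; rewrite E.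
Qed.

(** Iterated derivatives of products and composites have no convenient closed form. Grading by the
    order allows induction on [k], one derivative at a time. Order 0 already means
    differentiable. *)
Fixpoint Ck (R : realType) (V W : normedModType R) (k : nat) (U : set V)
    (f : V -> W) : Prop :=
  (forall x, U x -> differentiable f x) /\
  if k is k'.+1 then forall v, Ck k' U (fun x => 'D_v f x) else True.

Section Ck_theory.
Context {R : realType} {V : normedModType R}.
Implicit Types (U : set V) (k : nat).

Lemma CkP (W : normedModType R) U (f : V -> W) :
  (forall k, Ck k U f) -> smooth_on U f.
Proof.
(* The list is consumed from its end because its last direction is differentiated first. *)
move=> fk vs; elim/last_ind: vs f fk => [|vs v IH] f fk x Ux.
  by have [+ _] := fk 0%N; apply.
rewrite /iter_deriv -cats1 foldr_cat /=.
by apply: IH Ux => k; have [_] := fk k.+1; apply.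
Qed.

Lemma Ck_diff (W : normedModType R) k U (f : V -> W) x :
  Ck k U f -> U x -> differentiable f x.
Proof. by case: k => [|k] [+ _]; apply. Qed.

Lemma Ck_derive (W : normedModType R) k U (f : V -> W) v :
  Ck k.+1 U f -> Ck k U (fun x => 'D_v f x).
Proof. by case=> _; apply. Qed.

Lemma CkW (W : normedModType R) k U (f : V -> W) : Ck k.+1 U f -> Ck k U f.
Proof.
elim: k f => [|k IH] f [df Df]; split => // v.
by apply: IH; exact: Df.
Qed.

Lemma Ck_sub (W : normedModType R) k U U' (f : V -> W) :
  U' `<=` U -> Ck k U f -> Ck k U' f.
Proof.
move=> s; elim: k f => [|k IH] f [df Df]; split => //.
- by move=> x /s; exact: df.
- by move=> x /s; exact: df.
- by move=> v; apply: IH; exact: Df.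
Qed.

(** On an open set, equality holds near each point and so passes to derivatives. Later smoothness
    proofs build a function in a convenient shape and transport it by this lemma. *)
Lemma Ck_eq (W : normedModType R) k U (f g : V -> W) : open U ->
  (forall x, U x -> f x = g x) -> Ck k U f -> Ck k U g.
Proof.
move=> oU; elim: k f g => [|k IH] f g fg Cf.
  split => // x Ux; apply: (@near_eq_differentiable _ _ _ f).
    by apply: filterS (open_nbhs_nbhs (conj oU Ux)).
  exact: Ck_diff Cf Ux.
split=> [x Ux|v].
  apply: (@near_eq_differentiable _ _ _ f).
    by apply: filterS (open_nbhs_nbhs (conj oU Ux)).
  exact: Ck_diff Cf Ux.
apply: IH (Ck_derive v Cf) => x Ux.
apply: near_eq_derive.
by apply: filterS (open_nbhs_nbhs (conj oU Ux)).
Qed.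

Lemma Ck_cst (W : normedModType R) k U (a : W) : Ck k U (cst a).
Proof.
elim: k a => [|k IH] a; split => //.
move=> v; rewrite (_ : 'D_v (cst a) = cst 0) //.
by apply/funext => x; rewrite derive_cst.
Qed.

Lemma Ck_linear (W : normedModType R) k U (f : {linear V -> W}) :
  continuous f -> Ck k U f.
Proof.
move=> cf; case: k => [|k]; split => //.
- by move=> x _; exact: linear_differentiable.
- by move=> x _; exact: linear_differentiable.
move=> v; rewrite (_ : 'D_v f = cst (f v)); first exact: Ck_cst.
by apply/funext => x; rewrite deriveE ?diff_lin//; exact: linear_differentiable.
Qed.

Lemma Ck_add (W : normedModType R) k U (f g : V -> W) : open U ->
  Ck k U f -> Ck k U g -> Ck k U (fun x => f x + g x).
Proof.
move=> oU; elim: k f g => [|k IH] f g Cf Cg; split => //.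
- by move=> x Ux; apply: differentiableD; [exact: Ck_diff Cf Ux|exact: Ck_diff Cg Ux].
- by move=> x Ux; apply: differentiableD; [exact: Ck_diff Cf Ux|exact: Ck_diff Cg Ux].
move=> v; apply: Ck_eq (IH _ _ (Ck_derive v Cf) (Ck_derive v Cg)) => // x Ux.
by rewrite deriveD//; apply: diff_derivable;
  [exact: Ck_diff Cf Ux|exact: Ck_diff Cg Ux].
Qed.

Lemma Ck_sum (W : normedModType R) k U (I : Type) (r : seq I) (f : I -> V -> W) :
  open U -> (forall i, Ck k U (f i)) -> Ck k U (fun x => \sum_(i <- r) f i x).
Proof.
move=> oU Cf; elim: r => [|i r IH].
  by apply: Ck_eq (Ck_cst k U (0 : W)) => // x _; rewrite big_nil.
by apply: Ck_eq (Ck_add oU (Cf i) IH) => // x _; rewrite big_cons.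
Qed.

Lemma Ck_mul k U (f g : V -> R) : open U ->
  Ck k U f -> Ck k U g -> Ck k U (fun x => f x * g x).
Proof.
move=> oU; elim: k f g => [|k IH] f g Cf Cg; split => //.
- by move=> x Ux; apply: differentiableM; [exact: Ck_diff Cf Ux|exact: Ck_diff Cg Ux].
- by move=> x Ux; apply: differentiableM; [exact: Ck_diff Cf Ux|exact: Ck_diff Cg Ux].
move=> v; apply: Ck_eq (Ck_add oU (IH _ _ (CkW Cf) (Ck_derive v Cg))
  (IH _ _ (CkW Cg) (Ck_derive v Cf))) => // x Ux.
by rewrite deriveM//; apply: diff_derivable;
  [exact: Ck_diff Cf Ux|exact: Ck_diff Cg Ux].
Qed.

Lemma Ck_scalel (W : normedModType R) k U (f : V -> R) (w : W) : open U ->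
  Ck k U f -> Ck k U (fun x => f x *: w).
Proof.
move=> oU; elim: k f => [|k IH] f Cf; split => //.
- by move=> x Ux; apply: differentiableZl; exact: Ck_diff Cf Ux.
- by move=> x Ux; apply: differentiableZl; exact: Ck_diff Cf Ux.
move=> v; apply: Ck_eq (IH _ (Ck_derive v Cf)) => // x Ux.
have df : differentiable f x := Ck_diff Cf Ux.
by rewrite !deriveE ?diffZl//; exact: differentiableZl.
Qed.

End Ck_theory.

(** With [g] of one real variable the chain rule is a product of scalar functions,
    ['D_v f x * 'D_1 g (f x)], to which [Ck_mul] applies. *)
Lemma Ck_comp (R : realType) (V : normedModType R) k (U : set V) (A : set R)
    (g : R -> R) (f : V -> R) : open U ->
  (forall x, U x -> A (f x)) -> Ck k A g -> Ck k U f ->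
  Ck k U (fun x => g (f x)).
Proof.
move=> oU fA; elim: k g => [|k IH] g Cg Cf; split => //.
- move=> x Ux; apply: (@differentiable_comp _ _ _ _ f g); first exact: (Ck_diff Cf Ux).
  exact: (Ck_diff Cg (fA _ Ux)).
- move=> x Ux; apply: (@differentiable_comp _ _ _ _ f g); first exact: (Ck_diff Cf Ux).
  exact: (Ck_diff Cg (fA _ Ux)).
move=> v.
have C1 : Ck k U (fun x => 'D_v f x * 'D_1 g (f x)).
  by apply: Ck_mul oU (Ck_derive v Cf) _; exact: (IH _ (Ck_derive (1 : R) Cg) (CkW Cf)).
apply: Ck_eq C1 => // x Ux.
have df : differentiable f x := Ck_diff Cf Ux.
have dg : differentiable g (f x) := Ck_diff Cg (fA _ Ux).
have dgf : differentiable (g \o f) x by exact: differentiable_comp.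
have -> : (fun x => g (f x)) = g \o f by [].
rewrite [in RHS]deriveE; last exact: differentiable_comp.
rewrite (diff_comp df dg) /= (deriveE _ df) (deriveE _ dg).
by rewrite -[X in _ = 'd g _ X]mulr1 [in RHS]linearZ.
Qed.

Lemma derive_scale1 (R : realType) (f : R -> R) (x v : R) :
  differentiable f x -> 'D_v f x = v * 'D_1 f x.
Proof. by move=> df; rewrite !deriveE// -[in LHS](mulr1 v) [in LHS]linearZ. Qed.

(** Functions whose derivative is expressed through themselves (inverse, square root, [flat]) climb
    from order [k] to [k.+1] by this lemma. *)
Lemma CkS_real (R : realType) k (U : set R) (f f' : R -> R) : open U ->
  (forall x, U x -> is_derive x 1 f (f' x)) -> Ck k U f' -> Ck k.+1 U f.
Proof.
move=> oU df Cf'.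
have dfx x : U x -> differentiable f x.
  by move=> Ux; apply/derivable1_diffP; apply: ex_derive; exact: df.
split => // v.
apply: Ck_eq (Ck_mul oU (Ck_cst k U v) Cf') => // x Ux /=.
by rewrite derive_scale1; [rewrite (@derive_val _ _ _ _ _ _ _ (df _ Ux))|exact: dfx].
Qed.

Lemma Ck_inv (R : realType) k : Ck k [set x : R | x != 0] GRing.inv.
Proof.
have oU : open [set x : R | x != 0].
  exact: open_neq.
have H (x : R) : x != 0 -> is_derive x 1 GRing.inv (- (x^-1 * x^-1)).
  move=> x0; have dx := differentiable_Rinv x0.
  apply: DeriveDef; first exact/derivable1_diffP.
  by rewrite deriveE// diff_Rinv// /GRing.scale /= mulr1 -expr2 exprVn.
elim: k => [|k IH].
  by split => // x /= x0; exact: differentiable_Rinv.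
apply: (@CkS_real _ _ _ _ (fun x => - (x^-1 * x^-1))) => //.
have C1 := Ck_mul oU (Ck_cst k _ (-1 : R)) (Ck_mul oU IH IH).
by apply: Ck_eq C1 => // x _; rewrite /= mulN1r.
Qed.

Lemma Ck_sqrt (R : realType) k : Ck k [set x : R | 0 < x] Num.sqrt.
Proof.
have oU : open [set x : R | 0 < x] by exact: open_gt.
elim: k => [|k IH].
  split => // x /= x0; apply/derivable1_diffP.
  by apply: ex_derive; exact: is_derive1_sqrt.
apply: (@CkS_real _ _ _ _ (fun x => (2 * Num.sqrt x)^-1)) => //.
have C1 : Ck k [set x : R | 0 < x] (fun x => 2 * Num.sqrt x).
  exact: Ck_mul oU (Ck_cst k _ (2 : R)) IH.
apply: (@Ck_comp _ _ k _ [set x | x != 0] GRing.inv (fun x => 2 * Num.sqrt x))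
  => // [x /= x0|]; last exact: Ck_inv.
by rewrite mulf_neq0// gt_eqF// sqrtr_gt0.
Qed.

Lemma Ck_id (R : realType) k (U : set R) : Ck k U id.
Proof. by apply: (@Ck_linear _ _ _ k U idfun) => x; exact: cvg_id. Qed.

(** * A smooth bounded reparametrization of the line *)

Section flat.
Context {R : realType}.
Implicit Types (x : R) (k : nat).

(** The classical flat function [exp (- 1 / x)] divided by [x ^ k]. The whole family is introduced
    because it is closed under differentiation up to linear combinations. *)
Definition flat k x : R := if 0 < x then x^-1 ^+ k * expR (- x^-1) else 0.

Lemma flat_ge0 k x : 0 <= flat k x.
Proof.
rewrite /flat; case: ifP => // x0.
by rewrite mulr_ge0 ?expR_ge0// exprn_ge0// invr_ge0 ltW.
Qed.

Lemma flatS k x : x * flat k.+1 x = flat k x.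
Proof.
rewrite /flat; case: ifP => [x0|]; last by rewrite mulr0.
by rewrite exprS !mulrA divff ?gt_eqF// mul1r.
Qed.

(** The exponential of [1 / x] dominates the term of order [k + 2] of its series. The quadratic
    bound yields a zero derivative at the origin. *)
Lemma flat_le k x : flat k x <= k.+2`!%:R * x ^+ 2.
Proof.
rewrite /flat; case: ifPn => [x0|_]; last by rewrite mulr_ge0// sqr_ge0.
have xi0 : 0 <= x^-1 by rewrite invr_ge0 ltW.
have H : x^-1 ^+ k.+2 / k.+2`!%:R <= expR x^-1.
  by apply: le_trans (expR_ge1Dxn k.+1 xi0); rewrite lerDr.
rewrite expRN ler_pdivrMr ?expR_gt0//.
rewrite ler_pdivrMr ?ltr0n ?fact_gt0// in H.
have := ler_wpM2l (sqr_ge0 x) H.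
have -> : x^-1 ^+ k.+2 = x^-1 ^+ k * x^-1 ^+ 2 by rewrite -exprD addn2.
rewrite mulrCA -exprMn divff ?gt_eqF// expr1n mulr1.
by move=> /le_trans; apply; rewrite [leRHS]mulrAC mulrA mulrAC mulrC mulrA.
Qed.

Lemma is_derive_quadratic0 (f : R -> R) (K : R) :
  (forall h, `|f h| <= K * h ^+ 2) -> is_derive (0 : R) (1 : R) f 0.
Proof.
move=> fK.
have f0 : f 0 = 0.
  by apply/eqP; rewrite -normr_le0; have := fK 0; rewrite expr0n/= mulr0.
have H : h^-1 *: (f (h *: 1 + 0) - f 0) @[h --> 0^'] --> (0 : R).
  apply/cvgrPdist_le => e e0; near=> h.
  rewrite f0 subr0 sub0r normrN addr0 /GRing.scale/= mulr1.
  have h0 : h != 0 by near: h; exact: nbhs_dnbhs_neq.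
  rewrite normrM normfV ler_pdivrMl ?normr_gt0//.
  apply: (le_trans (fK h)); rewrite -real_normK ?num_real// expr2 mulrCA.
  rewrite ler_wpM2l//.
  apply: (@le_trans _ _ (`|K| * `|h|)); first by rewrite ler_wpM2r// ler_norm.
  have hb : `|h| <= e / (`|K| + 1).
    by near: h; apply: dnbhs0_le; rewrite divr_gt0// ltr_wpDl.
  rewrite ler_pdivlMr ?ltr_wpDl// in hb.
  by apply: le_trans hb; rewrite mulrC ler_wpM2l// lerDl.
by apply: DeriveDef; [apply/cvg_ex; exists 0|exact: cvg_lim H].
Unshelve. all: by end_near. Qed.

Lemma is_derive_flat k x :
  is_derive x 1 (flat k) (flat k.+2 x - k%:R * flat k.+1 x).
Proof.
have [x0|x0|->] := ltgtP x 0.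
- rewrite /flat ltNge ltW//= mulr0 subr0.
  apply: (@near_eq_is_derive _ _ _ (cst 0)).
  near=> y; rewrite /flat ltNge ltW//=.
  by near: y; exact: lt_nbhsl.
- have H : is_derive x 1 (fun y => y^-1 ^+ k * expR (- y^-1))
      (flat k.+2 x - k%:R * flat k.+1 x).
    have x0' : x != 0 by rewrite gt_eqF.
    have dV : is_derive x 1 (fun y : R => y^-1) (- (x^-1 ^+ 2)).
      apply: is_derive_eq; first exact: is_deriveV.
      by rewrite /GRing.scale/= mulr1 exprVn.
    have dX : is_derive x 1 (fun y : R => y^-1 ^+ k)
        (k%:R * x^-1 ^+ k.-1 * - (x^-1 ^+ 2)).
      by have := is_deriveX k dV; rewrite exprfctE.
    have dE : is_derive x 1 (fun y : R => expR (- y^-1)) (x^-1 ^+ 2 * expR (- x^-1)).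
      have dN : is_derive x 1 (fun y : R => - y^-1) (x^-1 ^+ 2).
        by have := is_deriveN dV; rewrite opprK.
      by rewrite mulrC; exact: (is_derive1_comp (is_derive_expR _) dN).
    apply: (is_derive_eq (is_deriveM dX dE)).
    rewrite /flat x0 /GRing.scale/=; case: k {dX} => [|k].
      by rewrite !expr0 !mul0r mulr0 subr0 addr0 mul1r.
    rewrite /= !exprS; ring.
  apply: near_eq_is_derive H; near=> y; rewrite /flat ifT//.
  by near: y; exact: lt_nbhsr.
- rewrite {2 3}/flat ltxx mulr0 subr0.
  apply: (@is_derive_quadratic0 _ k.+2`!%:R) => h.
  by rewrite ger0_norm ?flat_ge0//; exact: flat_le.
Unshelve. all: by end_near. Qed.

Lemma Ck_flat j k (U : set R) : Ck j U (flat k).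
Proof.
apply: (@Ck_sub _ _ _ _ setT) => //.
elim: j k => [|j IH] k.
  by split => // x _; apply/derivable1_diffP; apply: ex_derive; exact: is_derive_flat.
apply: (@CkS_real _ _ _ _ (fun x => flat k.+2 x - k%:R * flat k.+1 x)) => //.
- exact: openT.
- by move=> x _; exact: is_derive_flat.
have C1 := Ck_add openT (IH k.+2) (Ck_mul openT (Ck_cst j setT (- k%:R : R)) (IH k.+1)).
by apply: Ck_eq C1 => [|x _]; [exact: openT|rewrite /= mulNr].
Qed.

(* The identity on [x <= 0], then flattening out towards the asymptote 1. *)
Definition bend x : R := x - x * flat 0 x.

Definition bend' x : R := 1 - flat 0 x - flat 1 x.

Lemma Ck_bend k (U : set R) : Ck k U bend.
Proof.
apply: (@Ck_sub _ _ _ _ setT) => //.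
have C1 := Ck_add openT (Ck_id k setT) (Ck_mul openT (Ck_mul openT
   (Ck_cst k setT (-1 : R)) (Ck_id k setT)) (Ck_flat k 0 setT)).
by apply: Ck_eq C1 => [|x _]; [exact: openT|rewrite /= !mulN1r mulNr].
Qed.

Lemma is_derive_bend x : is_derive x 1 bend (bend' x).
Proof.
have H1 := is_derive_flat 0 x.
have H2 : is_derive x 1 (fun y : R => y * flat 0 y)
   (x *: (flat 2 x - 0%:R * flat 1 x) + flat 0 x *: 1).
  exact: (is_deriveM (is_derive_id x 1) H1).
apply: (is_derive_eq (is_deriveB (is_derive_id x 1) H2)).
rewrite /bend' /GRing.scale/= mul0r subr0 mulr1 flatS; ring.
Qed.

Lemma bend_le0 x : x <= 0 -> bend x = x.
Proof. by move=> x0; rewrite /bend /flat ltNge x0/= mulr0 subr0. Qed.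

Lemma bend'_le0 x : x <= 0 -> bend' x = 1.
Proof. by move=> x0; rewrite /bend' /flat ltNge x0/= !subr0. Qed.

Lemma bend'_le1 x : bend' x <= 1.
Proof. by rewrite /bend'; have := flat_ge0 0 x; have := flat_ge0 1 x; lra. Qed.

(** For [x > 0] and [u = 1 / x] the value is [1 - (1 + u) * exp (- u)], and [1 + u < exp u]. *)
Lemma bend'_gt0 x : 0 < bend' x.
Proof.
have [x0|x0] := leP x 0; first by rewrite bend'_le0.
rewrite /bend' /flat x0 expr0 expr1 mul1r.
set u := x^-1; have u0 : u != 0 by rewrite gt_eqF// invr_gt0.
have := expR_gt1Dx u0; rewrite expRN.
set E := expR u => H.
have E0 : 0 < E by exact: expR_gt0.
have -> : 1 - E^-1 - u * E^-1 = (E - (1 + u)) / E by field; rewrite gt_eqF.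
by rewrite divr_gt0// subr_gt0.
Qed.

(** Concavity of [bend]: in its second derivative the terms [flat 2] cancel and only [- flat 3] is
    left. *)
Lemma bend'_nincr x y : x <= y -> bend' y <= bend' x.
Proof.
move=> xy.
have D (z : R) : is_derive z 1 bend' (- flat 3 z).
  have H1 := is_derive_flat 0 z.
  have H2 := is_derive_flat 1 z.
  apply: (is_derive_eq (is_deriveB (is_deriveB (is_derive_cst (1 : R) z 1) H1) H2)).
  ring.
rewrite le_eqVlt in xy; case/orP: xy => [/eqP ->//|xy].
have cb : {within `[x, y], continuous bend'}.
  apply: derivable_within_continuous => z _; apply: ex_derive; exact: D.
have [z _ E] := MVT xy (fun z _ => D z) cb.
rewrite -subr_le0 E mulNr oppr_le0 mulr_ge0 ?flat_ge0//.
by rewrite subr_ge0 ltW.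
Qed.

Lemma bend_lt x y : x < y -> bend x < bend y.
Proof.
move=> xy.
have cb : {within `[x, y], continuous bend}.
  apply: derivable_within_continuous => z _; apply: ex_derive; exact: is_derive_bend.
have [z _ E] := MVT xy (fun z _ => is_derive_bend z) cb.
by rewrite -subr_gt0 E mulr_gt0 ?bend'_gt0// subr_gt0.
Qed.

(** For [x > 0] this is [x * (1 - exp (- 1 / x)) < 1], from [exp (- 1 / x) > 1 - 1 / x]. *)
Lemma bend_lt1 x : bend x < 1.
Proof.
have [x0|x0] := leP x 0; first by rewrite bend_le0// (le_lt_trans x0).
rewrite /bend /flat x0 expr0 mul1r.
have xi0 : - x^-1 != 0 by rewrite oppr_eq0 gt_eqF// invr_gt0.
have := expR_gt1Dx xi0.
rewrite -(ltr_pM2l x0) mulrDr mulr1 mulrN divff ?gt_eqF//; lra.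
Qed.

Lemma bend_le x : bend x <= x.
Proof.
have [x0|x0] := leP x 0; first by rewrite bend_le0.
by rewrite /bend gerBl mulr_ge0 ?flat_ge0// ltW.
Qed.

(** If [x > 2] then [u = 1 / x < 1 / 2], and [exp (- u) >= 1 - u] bounds the derivative by
    [u ^ 2 < 1 / 4]. *)
Lemma bend'_half x : 1 / 2 <= bend' x -> x <= 2.
Proof.
move=> H; rewrite leNgt; apply/negP => x2; have x0 : 0 < x by lra.
move: H; rewrite /bend' /flat x0 expr0 expr1 mul1r.
set u := x^-1; have u0 : 0 < u by rewrite invr_gt0.
have u2 : u < 1 / 2 by rewrite div1r ltf_pV2 ?posrE//; lra.
have := expR_ge1Dx (- u); set E := expR _ => HE; nra.
Qed.

End flat.

(** * The meridian *)

Section circ.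
Context {R : realType} (C S : R).
Hypotheses (S0 : 0 < S) (CS : C ^+ 2 + S ^+ 2 = 1).
Implicit Types t : R.

(** The radius of the unit sphere at height [C + t] above its centre. With [C = cos theta] and
    [S = sin theta], the offset [t = 0] marks the slope [- cot theta]. *)
Definition circ t : R := Num.sqrt (1 - (C + t) ^+ 2).

Definition dcirc t : R := - (C + t) / circ t.

Lemma circ0 : circ 0 = S.
Proof. by rewrite /circ addr0 -CS addrC addKr sqrtr_sqr gtr0_norm. Qed.

Lemma dcirc0 : dcirc 0 = - C / S.
Proof. by rewrite /dcirc circ0 addr0. Qed.

Lemma norm_lt1_sqr (x : R) : `|x| < 1 -> 0 < 1 - x ^+ 2.
Proof. by rewrite ltr_norml => /andP[? ?]; nra. Qed.

Lemma circ_gt0 t : `|C + t| < 1 -> 0 < circ t.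
Proof. by move=> /norm_lt1_sqr; rewrite /circ sqrtr_gt0. Qed.

Lemma sqr_circ t : `|C + t| < 1 -> circ t ^+ 2 = 1 - (C + t) ^+ 2.
Proof. by move=> /norm_lt1_sqr H; rewrite sqr_sqrtr// ltW. Qed.

Lemma is_derive_circ t : `|C + t| < 1 -> is_derive t 1 circ (dcirc t).
Proof.
move=> t1; have p0 := norm_lt1_sqr t1.
have d1 : is_derive t 1 (fun x : R => C + x) (0 + 1).
  exact: (is_deriveD (is_derive_cst C t 1) (is_derive_id t 1)).
have d2 := is_deriveX 2 d1; rewrite exprfctE in d2.
have d3 := is_deriveB (is_derive_cst (1 : R) t 1) d2.
have d4 := @is_derive1_comp _ Num.sqrt (fun x => 1 - (C + x) ^+ 2) _ _ _
  (is_derive1_sqrt p0) d3.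
apply: (is_derive_eq d4); rewrite /dcirc /circ /GRing.scale/=.
by field; rewrite gt_eqF// sqrtr_gt0.
Qed.

Lemma dcirc_pos t : `|C + t| < 1 -> 0 < t -> dcirc t < - C / S.
Proof.
move=> t1 tp; have CS' := CS; have S0' := S0.
have a0 := circ_gt0 t1; have := sqr_circ t1.
rewrite /dcirc ltr_pdivrMr// mulrAC ltr_pdivlMr//.
move: (circ t) a0 => s a0 E; clear t1.
(* With [s = circ t] the goal amounts to [C * s < (C + t) * S]. The signs of [C] and [C + t] decide
   whether [s] has to be compared with [S], and in which direction. *)
have tS := mulr_gt0 tp S0.
have [C0|C0] := leP 0 C.
  have s2 : s ^+ 2 < S ^+ 2 by nra.
  have sS : s < S by rewrite -(@ltr_pXn2r _ 2)// ?nnegrE ?ltW.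
  by have := ler_wpM2l C0 (ltW sS); lra.
have Cs : C * s < 0 by rewrite nmulr_rlt0.
have [Ct|Ct] := leP 0 (C + t); first by have := mulr_ge0 Ct (ltW S0); lra.
have s2 : S ^+ 2 < s ^+ 2 by nra.
have sS : S < s by rewrite -(@ltr_pXn2r _ 2)// ?nnegrE ?ltW.
by have := ler_wnM2l (ltW C0) (ltW sS); lra.
Qed.

(** Fixes the half-width [d] of the zone. Offsets up to [2 * d] are all that [slide] produces; the
    bound on slopes serves [mix_close], while those on radii and on [M * d] keep the relevant radii
    within a factor 2. *)
Lemma circ_near (M e : R) : 0 <= M -> 0 < e -> exists d : R,
  [/\ 0 < d, `|C| + 2 * d < 1, 8 * M * d <= S &
   forall t, `|t| <= 2 * d -> `|dcirc t - - C / S| <= e /\ `|circ t - S| <= S / 4].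
Proof.
move=> M0 e0; have [CS' S0'] := (CS, S0).
have C1 : `|C| < 1.
  by rewrite ltr_norml; apply/andP; split; nra.
have C01 : `|C + 0| < 1 by rewrite addr0.
have ca : {for 0, continuous circ}.
  apply: differentiable_continuous; apply/derivable1_diffP; apply: ex_derive.
  exact: is_derive_circ.
have cda : {for 0, continuous dcirc}.
  apply: cvgM.
    apply: cvgN; apply: cvgD; [exact: cvg_cst|exact: cvg_id].
  by apply: cvgV => //; rewrite circ0 gt_eqF.
have /cvgrPdist_le/(_ _ e0) := cda; rewrite dcirc0 => n1.
have S4 : 0 < S / 4 by lra.
have /cvgrPdist_le/(_ _ S4) := ca; rewrite circ0 => n2.
have : nbhs (0 : R) [set t | `|- C / S - dcirc t| <= e /\ `|S - circ t| <= S / 4].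
  exact: filterI n1 n2.
move=> /nbhs_ballP[r /= r0 H].
pose d := Num.min (r / 4) (Num.min ((1 - `|C|) / 4) (S / (8 * (M + 1)))).
have d0 : 0 < d.
  rewrite /d !lt_min; apply/and3P; split; [lra|lra|].
  by rewrite divr_gt0//; nra.
have d1 : d <= r / 4 by rewrite /d ge_min lexx.
have d2 : d <= (1 - `|C|) / 4 by rewrite /d !ge_min lexx orbT.
have d3 : d <= S / (8 * (M + 1)) by rewrite /d !ge_min lexx !orbT.
exists d; split => //; [lra| |].
  by rewrite ler_pdivlMr in d3; nra.
move=> t td; have [] := H t; last by rewrite distrC => ? ; rewrite distrC.
by rewrite /ball/= sub0r normrN; lra.
Qed.

End circ.

(** Reflecting the circle in the horizontal line through its centre changes the signs of [C], [t]
    and the slope, which reduces the claim to [dcirc_pos]. *)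
Lemma dcirc_neg (R : realType) (C S t : R) : 0 < S -> C ^+ 2 + S ^+ 2 = 1 ->
  `|C + t| < 1 -> t < 0 -> - C / S < dcirc C t.
Proof.
move=> S0 CS t1 tn.
have t1' : `|- C + - t| < 1 by rewrite -opprD normrN.
have := @dcirc_pos R (- C) S S0 _ (- t) t1'; rewrite sqrrN oppr_gt0.
move=> /(_ CS tn); rewrite /dcirc /circ -opprD sqrrN opprK mulNr; lra.
Qed.

Section profile.
Context {R : realType} (C S M d : R).
Hypotheses (S0 : 0 < S) (CS : C ^+ 2 + S ^+ 2 = 1) (M0 : 0 <= M).
Hypotheses (d0 : 0 < d) (Cd : `|C| + 2 * d < 1).
Implicit Types z : R.

Let u z : R := (z - 2 * d) / d.

(** The offset on the circle reached at height [z]: it is [z - d] up to height [2 * d], then lags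
    behind and stays below [2 * d]. *)
Definition slide z : R := d * (1 + bend (u z)).

Definition slide' z : R := bend' (u z).

(** The linear term is carried by the lag [z - d - slide z], which vanishes up to height [2 * d].
    The profile is therefore a single smooth formula and needs no gluing. *)
Definition profile z : R := circ C (slide z) + M * (z - d - slide z).

(** A mean of the slope of the circle and of [M], with weight [slide' z]; this is the shape treated
    by [mix_close]. *)
Definition profile' z : R := slide' z * dcirc C (slide z) + (1 - slide' z) * M.

Let u_lt z1 z2 : z1 < z2 -> u z1 < u z2.
Proof. by move=> ?; rewrite /u ltr_pM2r ?invr_gt0// ltrD2r. Qed.

Lemma slide_lt z1 z2 : z1 < z2 -> slide z1 < slide z2.
Proof. by move=> ?; rewrite /slide ltr_pM2l// ltrD2l bend_lt// u_lt. Qed.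

Lemma slideE z : z <= 2 * d -> slide z = z - d.
Proof.
move=> zd; rewrite /slide bend_le0 /u.
  by field; rewrite gt_eqF.
by rewrite pmulr_lle0 ?invr_gt0// subr_le0.
Qed.

Lemma slide'E z : z <= 2 * d -> slide' z = 1.
Proof.
move=> zd; rewrite /slide' bend'_le0// /u.
by rewrite pmulr_lle0 ?invr_gt0// subr_le0.
Qed.

Lemma slide_lt2 z : slide z < 2 * d.
Proof. have d0' := d0; by rewrite /slide; have := bend_lt1 (u z); nra. Qed.

Lemma slide_gt z : - d < z -> - (2 * d) < slide z.
Proof. have d0' := d0; by move=> /slide_lt; rewrite (@slideE (- d)); lra. Qed.

Lemma slide_le z : slide z <= z - d.
Proof.
rewrite /slide; have := bend_le (u z); rewrite {2}/u => H.
have : d * bend (u z) <= z - 2 * d.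
  by rewrite mulrC -ler_pdivlMr.
lra.
Qed.

(** A weight of at least [1 / 2] forces [z <= 4 * d], and [slide z > d] as soon as [z > 2 * d]; the
    lag is then at most [4 * d - d - d]. *)
Lemma slide_gap z : 1 / 2 <= slide' z -> z - d - slide z <= 2 * d.
Proof.
move=> /bend'_half; rewrite /u ler_pdivrMr// => zd; have d0' := d0.
have [z2|z2] := leP z (2 * d); first by rewrite slideE// subrr; lra.
have := slide_lt z2; rewrite slideE//; lra.
Qed.

Lemma slide'_nincr z1 z2 : z1 <= z2 -> slide' z2 <= slide' z1.
Proof.
by move=> ?; apply: bend'_nincr; rewrite /u ler_pM2r ?invr_gt0// lerD2r.
Qed.

Lemma slide_bound z : - d < z -> `|slide z| < 2 * d.
Proof. by move=> zd; rewrite ltr_norml slide_gt//= slide_lt2. Qed.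

Lemma circ_dom t : `|t| < 2 * d -> `|C + t| < 1.
Proof.
by move=> td; apply: (le_lt_trans (ler_normD _ _)); have := Cd; lra.
Qed.

Lemma slide_dom z : - d < z -> `|C + slide z| < 1.
Proof. by move=> /slide_bound/circ_dom. Qed.

Lemma is_derive_slide z : is_derive z 1 slide (slide' z).
Proof.
have d1 := is_deriveB (is_derive_id z 1) (is_derive_cst (2 * d : R) z 1).
have d2 := is_deriveZ d^-1 d1.
have d3 : is_derive z 1 (bend \o u) (bend' (u z) * d^-1).
  apply: is_derive1_comp; first exact: is_derive_bend.
  rewrite (_ : u = d^-1 *: (id \- cst (2 * d))); last first.
    by apply/funext => x; rewrite /u mulrC.
  by apply: (is_derive_eq d2); rewrite /GRing.scale/= subr0 mulr1.
have d4 := is_deriveZ d (is_deriveD (is_derive_cst (1 : R) z 1) d3).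
apply: (is_derive_eq d4); rewrite /GRing.scale/= /slide'; field.
by rewrite gt_eqF.
Qed.

Lemma is_derive_profile z : - d < z -> is_derive z 1 profile (profile' z).
Proof.
move=> zd.
have ds := is_derive_slide z.
have d1 := is_derive1_comp (is_derive_circ (slide_dom zd)) ds.
have d2 := is_deriveB (is_deriveB (is_derive_id z 1) (is_derive_cst (d : R) z 1)) ds.
have d3 := is_deriveD d1 (is_deriveZ M d2).
apply: (is_derive_eq d3); rewrite /profile' /GRing.scale/=; ring.
Qed.

Lemma derive1_profile z : - d < z -> derive1 profile z = profile' z.
Proof.
by move=> zd; rewrite derive1E; apply: derive_val; exact: is_derive_profile.
Qed.

Lemma Ck_slide k (U : set R) : open U -> Ck k U slide.
Proof.
move=> oU.
have C0 : Ck k U u.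
  have := Ck_mul oU (Ck_add oU (Ck_id k U) (Ck_cst k U (- (2 * d) : R)))
     (Ck_cst k U (d^-1 : R)).
  exact: Ck_eq.
have C1 : Ck k U (fun z => bend (u z)).
  by apply: (@Ck_comp _ _ k U setT bend u) => //; exact: Ck_bend.
have := Ck_mul oU (Ck_cst k U (d : R)) (Ck_add oU (Ck_cst k U (1 : R)) C1).
exact: Ck_eq.
Qed.

Lemma smooth_profile : smooth_on [set z | - d < z] profile.
Proof.
apply: CkP => k.
have oU : open [set z : R | - d < z] by exact: open_gt.
set U := [set z | _] in oU *.
have C1 : Ck k U slide by exact: Ck_slide.
have C2 : Ck k U (fun z => C + slide z) by exact: Ck_add oU (Ck_cst k U (C : R)) C1.
have C3 : Ck k U (fun z => 1 - (C + slide z) ^+ 2).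
  have := Ck_add oU (Ck_cst k U (1 : R)) (Ck_mul oU (Ck_cst k U (-1 : R))
    (Ck_mul oU C2 C2)).
  by apply: Ck_eq => // z _ /=; rewrite mulN1r expr2.
have C4 : Ck k U (fun z => Num.sqrt (1 - (C + slide z) ^+ 2)).
  apply: (@Ck_comp _ _ k U [set x | 0 < x] Num.sqrt) => //; last exact: Ck_sqrt.
  by move=> z /= zd; apply: norm_lt1_sqr; exact: slide_dom.
have C5 := Ck_add oU (Ck_add oU (Ck_id k U) (Ck_cst k U (- d : R)))
  (Ck_mul oU (Ck_cst k U (-1 : R)) C1).
have := Ck_add oU C4 (Ck_mul oU (Ck_cst k U (M : R)) C5).
by apply: Ck_eq => // z _ /=; rewrite mulN1r.
Qed.

Lemma profile_gt0 z : - d < z -> 0 < profile z.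
Proof.
move=> zd; rewrite /profile ltr_pwDl ?mulr_ge0//; first exact/circ_gt0/slide_dom.
by rewrite subr_ge0 slide_le.
Qed.

Lemma profile_circ z : z <= 2 * d -> profile z = circ C (z - d).
Proof. by move=> zd; rewrite /profile slideE// subrr mulr0 addr0. Qed.

Lemma profile'_circ z : z <= 2 * d -> profile' z = dcirc C (z - d).
Proof. by move=> zd; rewrite /profile' slideE// slide'E// subrr mul0r addr0 mul1r. Qed.

End profile.

(** * Supports of infinite height and the choice of the meridian *)

Lemma heights_infinite (R : realType) : heights +oo%E = `[0, +oo[%classic :> set R.
Proof.
apply/seteqP; split => z /=; rewrite in_itv/= andbT; first by case.
by move=> z0; split => //; rewrite ltry.
Qed.

(** A compact set bounds the height, whence properness; the length integrand is at least 1 on a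
    half-line of infinite measure, whence completeness. *)
Lemma rotational_support_infinite (R : realType) (rho : R -> R) (d : R) :
  0 < d -> smooth_on [set z | - d < z] rho ->
  (forall z, 0 <= z -> 0 < rho z) -> rotational_support +oo%E rho.
Proof.
move=> d0 rs rp; split.
- exact: ltry.
- by exists d => // vs z [? _]; exact: rs.
- by move=> z [+ _]; exact: rp.
- move=> K /compact_bounded[N [_ NK]].
  exists (`|N| + 1); first by split; [rewrite addr_ge0|rewrite ltry].
  move=> z [z0 _] Nz /(NK (N + 1 / 2)).
  rewrite ltrDl => /(_ _)/wrap[]; first by lra.
  move=> H; have := le_trans _ H; move=> /(_ z).
  rewrite prod_normE/= le_max ler_norm orbT => /(_ isT).
  by have := ler_norm N; lra.
- rewrite heights_infinite.
  set g := fun z => Num.sqrt (1 + (derive1 rho z) ^+ 2).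
  have oU : open [set z : R | - d < z] by exact: open_gt.
  have mg : measurable_fun (`[0, +oo[%classic : set R) g.
    apply: (@measurable_funS _ _ _ _ [set z | - d < z]).
    - exact: open_measurable.
    - by move=> z /=; rewrite in_itv/= andbT => z0; lra.
    apply: open_continuous_measurable_fun => // z; rewrite inE/= => zd.
    apply: (@continuous_comp _ _ _ (fun z => 1 + (derive1 rho z) ^+ 2) Num.sqrt);
      last exact: sqrt_continuous.
    apply: cvgD; first exact: cvg_cst.
    have cD : {for z, continuous (derive1 rho)}.
      rewrite (_ : derive1 rho = 'D_1 rho); last by apply/funext => x; rewrite derive1E.
      exact: differentiable_continuous (rs [:: 1] z zd).
    by apply: cvgM.
  apply/eqP; rewrite eq_le leey/=.
  have <- : (\int[lebesgue_measure]_(z in (`[0%R, +oo[%classic : set R))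
      (cst 1%E : R -> \bar R) z = +oo)%E.
    rewrite integral_cst// mul1e.
    by have /= := lebesgue_measure_itv (`[0, +oo[ : interval R); rewrite ltry.
  apply: ge0_le_integral => //.
  - exact/measurable_EFinP.
  - move=> z _; rewrite lee_fin -{1}sqrtr1 ler_wsqrtr// lerDl; exact: sqr_ge0.
Qed.

(** Positivity of [b] excludes the default value 0 of [ell], so the supremum is over a nonempty
    set. *)
Lemma lt_ell (R : realType) (L : \bar R) (rho : R -> R) (theta b : R) : 0 < b ->
  (b%:E < ell L rho theta)%E ->
  exists z, [/\ heights L z, b < z & derive1 rho z < - cot theta].
Proof.
rewrite /ell => b0; case: asboolP => [_|_ /ereal_sup_gt[_ [z [hz dz] <-]]].
  by rewrite lte_fin ltNge ltW.
by rewrite lte_fin => bz; exists z.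
Qed.

(* Since M - m >= e, the later mean (weight w') can be below m only if w', hence
   also the earlier weight w >= w', puts little mass on M. *)
Lemma mix_close (R : realFieldType) (m M f f' w w' e : R) :
  0 < e -> e <= M - m -> `|f - m| <= e -> `|f' - m| <= e ->
  0 < w' -> w' <= w -> w <= 1 -> w' * f' + (1 - w') * M < m ->
  1 / 2 <= w /\ `|w * f + (1 - w) * M - m| <= 2 * e.
Proof.
move=> e0 eM; rewrite !ler_norml => /andP[f1 f2] /andP[g1 g2] w0 ww w1 H.
have H1 : M - m < w' * (M - m + e).
  have : w' * (m - f') <= w' * e by rewrite ler_wpM2l//; lra.
  lra.
have w2 : 1 / 2 <= w' by nra.
split; first lra.
have H2 : (1 - w') * (M - m) <= e by nra.
have H3 : 0 <= (1 - w) * (M - m) by rewrite mulr_ge0; lra.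
have H4 : (1 - w) * (M - m) <= (1 - w') * (M - m) by rewrite ler_wpM2r; lra.
have H5 : w * (f - m) <= e by nra.
have H6 : - e <= w * (f - m) by nra.
by apply/andP; split; lra.
Qed.

Lemma sqrt1D_le (R : realType) (x : R) : Num.sqrt (1 + x ^+ 2) <= 1 + `|x|.
Proof.
have -> : 1 + `|x| = Num.sqrt ((1 + `|x|) ^+ 2).
  by rewrite sqrtr_sqr [RHS]ger0_norm// addr_ge0.
rewrite ler_wsqrtr//.
have := normr_ge0 x; have := real_normK (num_real x); nra.
Qed.

Lemma sqrt1D_ge (R : realType) (x : R) : 1 <= Num.sqrt (1 + x ^+ 2).
Proof. by rewrite -{1}sqrtr1 ler_wsqrtr// lerDl sqr_ge0. Qed.

(** Here [tan theta * m = -1]. Hence [A_] at [b] is at most [k * rho b ^+ n.-1], while [B_] at [a]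
    is at least [rho a ^+ n.-1 / (2 + |m|)]. The ratio of the radii costs the factor [2 ^+ n.-1]. *)
Lemma A_lt_B (R : realType) (n : nat) (rho : R -> R) (theta a b k m : R) :
  0 < sin theta -> m = - cot theta -> cos theta != 0 ->
  0 <= k <= 1 -> 2 ^+ n.-1 * k * (2 + `|m|) < 1 ->
  0 < rho a -> 0 < rho b -> rho b <= 2 * rho a ->
  (forall z, (z == a) || (z == b) -> `|derive1 rho z - m| <= 1 /\
     `|tan theta * (derive1 rho z - m)| <= k) ->
  A_ n rho theta b < B_ n rho theta a.
Proof.
move=> s0 mE c0 /andP[k0 k1] kn ra rb rab H.
have [|_ Hb] := H b; first by rewrite eqxx orbT.
have [|Ha1 Ha] := H a; first by rewrite eqxx.
have tm : tan theta * m = -1.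
  by rewrite mE /tan /cot; field; rewrite c0 gt_eqF.
rewrite !mulrBr !tm in Hb Ha.
rewrite /A_ /B_.
move: (derive1 rho b) Hb => pb Hb.
move: (derive1 rho a) Ha Ha1 => pa Ha Ha1.
have sb := sqrt1D_ge pb; have sa := sqrt1D_ge pa; have sa' := sqrt1D_le pa.
have pam : `|pa| <= 1 + `|m|.
  by rewrite -(subrK m pa); apply: (le_trans (ler_normD _ _)); rewrite lerD2r.
have sb0 : 0 < Num.sqrt (1 + pb ^+ 2) by apply: lt_le_trans sb.
have sa0 : 0 < Num.sqrt (1 + pa ^+ 2) by apply: lt_le_trans sa.
have m0 := normr_ge0 m.
have [Hb1 Ha2] : 1 + tan theta * pb <= k /\ 1 <= 1 - tan theta * pa.
  by move: Hb Ha; rewrite !ler_norml => /andP[? ?] /andP[? ?]; split; lra.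
apply: (@le_lt_trans _ _ (rho b ^+ n.-1 * k)).
  rewrite ler_pdivrMr//.
  apply: (@le_trans _ _ (rho b ^+ n.-1 * k)).
    by rewrite ler_wpM2l// exprn_ge0// ltW.
  by rewrite ler_peMr// mulr_ge0// exprn_ge0// ltW.
apply: (@lt_le_trans _ _ (rho a ^+ n.-1 / (2 + `|m|))).
  apply: (@le_lt_trans _ _ ((2 * rho a) ^+ n.-1 * k)).
    by rewrite ler_wpM2r// lerXn2r// ?nnegrE ltW// mulr_gt0.
  rewrite ltr_pdivlMr; last lra.
  have r0 : 0 < rho a ^+ n.-1 by rewrite exprn_gt0.
  rewrite exprMn mulrAC [X in X < _]mulrAC -[ltRHS]mul1r.
  rewrite [X in X < _](_ : _ = 2 ^+ n.-1 * k * (2 + `|m|) * rho a ^+ n.-1).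
    by rewrite ltr_pM2r.
  ring.
rewrite -mulrA ler_wpM2l//; first by rewrite exprn_ge0// ltW.
rewrite ler_pdivlMr//.
apply: le_trans Ha2.
rewrite mulrC ler_pdivrMr; lra.
Qed.

Lemma meridian_exists (R : realType) (n : nat) (theta : R) : 0 < theta < pi ->
  exists (d : R) (rho : R -> R),
  [/\ 0 < d /\ `|cos theta| + 2 * d < 1,
      rotational_support +oo%E rho /\ no_cylindrical_interval +oo%E rho,
      forall z, - d < z < 2 * d ->
        rho z = Num.sqrt (1 - (cos theta + (z - d)) ^+ 2) /\
        derive1 rho z = - (cos theta + (z - d)) / rho z,
      ~ slope_condition +oo%E rho theta &
      theta != pi / 2 -> forall a b : R, 0 < a -> a < b ->
        (b%:E < ell +oo%E rho theta)%E -> A_ n rho theta b < B_ n rho theta a].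
Proof.
move=> /[dup] th /andP[th0 thpi].
have S0 : 0 < sin theta by rewrite sin_gt0_pi.
have CS := cos2Dsin2 theta.
have cotE : - cot theta = - cos theta / sin theta by rewrite /cot mulNr.
set C := cos theta in CS cotE *; set S := sin theta in S0 CS cotE *.
pose m := - C / S.
(* [M] must be nonnegative for the profile to stay positive, and above [m] when [C != 0]: 0 suffices
   for [C > 0], where [m < 0]. For [C = 0] no comparison of [A_] and [B_] is required. *)
pose M := if C < 0 then m + 1 else 0.
have mneg : C < 0 -> 0 < m by move=> C0; rewrite /m divr_gt0// oppr_gt0.
have mpos : 0 < C -> m < 0.
  by move=> C0; rewrite /m mulNr oppr_lt0 divr_gt0.
have M0 : 0 <= M.
  by rewrite /M; case: ifP => // /mneg; lra.
have mM : C != 0 -> 0 < M - m.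
  rewrite /M neq_lt => /orP[C0|C0]; first by rewrite C0 addrAC subrr add0r.
  by rewrite (lt_gtF C0) sub0r oppr_gt0 mpos.
(* Chosen so that [2 ^+ n.-1 * k * (2 + |m|)] equals [1 / 2]. *)
pose k := (2 ^+ n.-1 * (4 + 2 * `|m|))^-1.
have n2 : 1 <= 2 ^+ n.-1 :> R by rewrite exprn_ege1// ler1n.
have am := normr_ge0 m.
have kd : 4 <= 2 ^+ n.-1 * (4 + 2 * `|m|).
  by apply: (@le_trans _ _ (1 * (4 + 2 * `|m|))); [lra|rewrite ler_wpM2r//; lra].
have k0 : 0 < k by rewrite invr_gt0; lra.
have k1 : k <= 1 by rewrite invf_le1; lra.
have kn : 2 ^+ n.-1 * k * (2 + `|m|) < 1.
  rewrite /k [ltLHS](_ : _ = 1 / 2); first lra.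
  by field; apply/andP; split; lra.
(* [mix_close] needs [e <= M - m] and returns the error [2 * e], to which the hypotheses of [A_lt_B]
   apply; [2 * e <= |m|] keeps the slopes positive when [C < 0]. *)
have [e [e0 eC]] : exists e, 0 < e /\ (C != 0 -> [/\ 2 * e <= 1, e <= M - m,
    2 * e * `|tan theta| <= k & 2 * e <= `|m|]).
  have [C0|C0] := eqVneq C 0; first by exists 1.
  have mM0 := mM C0.
  have m0 : 0 < `|m|.
    by rewrite normr_gt0 /m mulf_neq0 ?oppr_eq0// invr_neq0// gt_eqF.
  have at0 := normr_ge0 (tan theta).
  exists (Num.min (1 / 2) (Num.min (M - m)
    (Num.min (k / (2 * `|tan theta| + 1)) (`|m| / 2)))).
  set e := Num.min _ _.
  have e1 : e <= 1 / 2 by rewrite /e ge_min lexx.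
  have e2 : e <= M - m by rewrite /e !ge_min lexx orbT.
  have e3 : e <= k / (2 * `|tan theta| + 1) by rewrite /e !ge_min lexx !orbT.
  have e4 : e <= `|m| / 2 by rewrite /e !ge_min lexx !orbT.
  have e0 : 0 < e.
    by rewrite /e !lt_min mM0 divr_gt0//= ?divr_gt0//; lra.
  split => // _; split => //; [lra| |lra].
  by rewrite ler_pdivlMr in e3; nra.
have [d [d0 Cd Md Hd]] := circ_near S0 CS M0 e0.
have dcircm t : `|t| < 2 * d -> `|dcirc C t - m| <= e by move=> /ltW/Hd[].
have circS t : `|t| < 2 * d -> `|circ C t - S| <= S / 4 by move=> /ltW/Hd[].
have P' z : - d < z -> derive1 (profile C M d) z = profile' C M d z.
  by move=> zd; rewrite (derive1_profile _ d0 Cd).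
have P0 z : - d < z -> 0 < profile C M d z by exact: profile_gt0.
have dpos z : 0 <= z -> - d < z.
  by clear -d0 => z0; lra.
exists d, (profile C M d); split => //.
- split.
    apply: (rotational_support_infinite d0); first exact: smooth_profile.
    by move=> z z0; exact/P0/dpos.
  move=> a b [a0 _] [b0 _] ab Hz.
  (* For [C < 0] each slope is a mean of two positive numbers. Otherwise [M = 0] and the slope
     vanishes only where [C + slide z = 0], which the increasing [slide] meets at most once. *)
  have [C0|C0] := ltP C 0.
    have Cn0 : C != 0 by rewrite lt_eqF.
    have [_ _ _] := eC Cn0; rewrite gtr0_norm ?mneg// => em.
    have m0 := mneg C0.
    have := Hz a; rewrite lexx ltW// P' ?dpos//.
    move=> /(_ isT); apply/eqP; rewrite gt_eqF//.
    rewrite /profile' /M C0.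
    have : `|slide d a| < 2 * d by apply: slide_bound => //; exact: dpos.
    move=> /dcircm; rewrite ler_norml => /andP[f1 f2].
    have w0 : 0 < slide' d a by exact: bend'_gt0.
    have w1 : slide' d a <= 1 by exact: bend'_le1.
    move: (slide' d a) (dcirc C _) w0 w1 f1 f2 => w f w0 w1 f1 f2.
    have : 0 < w * f by rewrite mulr_gt0//; clear -em f1 e0; lra.
    have : 0 <= (1 - w) * (m + 1).
      by rewrite mulr_ge0//; [rewrite subr_ge0|rewrite addr_ge0 ?ler01 ?(ltW m0)].
    by clear; lra.
  have Z z : a <= z <= b -> C + slide d z = 0.
    move=> /[dup] zab /andP[az zb]; have := Hz z zab.
    rewrite P' ?dpos ?(le_trans a0 az)//.
    rewrite /profile' /M ltNge C0/= mulr0 addr0 => /eqP.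
    rewrite mulf_eq0 gt_eqF ?bend'_gt0//= /dcirc mulf_eq0 invr_eq0.
    rewrite [X in _ || X]gt_eqF ?orbF ?oppr_eq0; last first.
      by apply: circ_gt0; apply: (slide_dom d0 Cd); apply/dpos/(le_trans a0 az).
    by move/eqP.
  have Za := Z a; have Zb := Z b.
  rewrite lexx ltW//= in Za; rewrite lexx ltW//= in Zb.
  have := slide_lt d0 ab; have := Za isT; have := Zb isT; clear; lra.
- move=> z /andP[zd z2]; rewrite P'//.
  by rewrite profile'_circ ?profile_circ// ltW.
(* The two heights lie on either side of [d], where the slope is exactly [m]. *)
- move=> sc; have := sc (d / 2) (3 * d / 2) _ _ (ltry _).
  have [h1 h2] : 0 < d / 2 /\ d / 2 < 3 * d / 2 by clear -d0; split; lra.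
  have h3 : 3 * d / 2 <= 2 * d by clear -d0; lra.
  rewrite cotE !P' ?dpos ?(ltW h1) ?(ltW (lt_trans h1 h2))//.
  rewrite !profile'_circ ?(ltW (lt_le_trans h2 h3))//.
  have N1 : `|d / 2 - d| < 2 * d.
    by clear -d0; rewrite ltr_norml; apply/andP; split; lra.
  have N2 : `|3 * d / 2 - d| < 2 * d.
    by clear -d0; rewrite ltr_norml; apply/andP; split; lra.
  have D2 : dcirc C (3 * d / 2 - d) < m.
    by apply: dcirc_pos => //; [exact: (circ_dom Cd)|clear -d0; lra].
  have D1 : m < dcirc C (d / 2 - d).
    by apply: dcirc_neg => //; [exact: (circ_dom Cd)|clear -d0; lra].
  rewrite -/m => H; have : m <= dcirc C (3 * d / 2 - d) by exact: H.
  by rewrite leNgt D2.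
- move=> thpi2 a b a0 ab /(lt_ell (lt_trans a0 ab))[z [_ bz]].
  have b0 := lt_trans a0 ab; have z0 := lt_trans b0 bz.
  rewrite cotE -/m P' ?dpos ?(ltW z0)// => zm.
  have Cn0 : C != 0.
    apply: contra_neq thpi2 => C0; apply: cos_inj.
    - by rewrite in_itv/= !ltW.
    - by clear; rewrite in_itv/=; have := pi_gt0 R; lra.
    - by rewrite cos_pihalf.
  have [e1 eM ek _] := eC Cn0.
  (* The height [z], above [b], has slope below [m]; [mix_close] carries this information back to
     every earlier height. *)
  have key x : 0 < x -> x <= z ->
      1 / 2 <= slide' d x /\ `|profile' C M d x - m| <= 2 * e.
    move=> x0 xz; apply: (mix_close (f' := dcirc C (slide d z)) (w' := slide' d z)) => //.
    - by apply: dcircm; apply: slide_bound => //; apply: dpos; exact: ltW.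
    - by apply: dcircm; apply: slide_bound => //; apply: dpos; exact: ltW.
    - exact: bend'_gt0.
    - exact: slide'_nincr.
    - exact: bend'_le1.
  have az : a <= z by exact: ltW (lt_trans ab bz).
  have [_ ka] := key a a0 az.
  have [wb kb] := key b b0 (ltW bz).
  apply: (@A_lt_B _ _ _ _ _ _ k m) => //.
  + by rewrite ltW.
  + by apply/P0/dpos/ltW.
  + by apply/P0/dpos/ltW.
  (* The radius at [b] is at most [5 / 4 * S + 2 * M * d <= 3 / 2 * S], and the radius at [a] is at
     least [3 / 4 * S]. *)
  + have ha : - d < a by exact/dpos/ltW.
    have hb : - d < b by exact/dpos/ltW.
    have := circS _ (slide_bound d0 ha); have := circS _ (slide_bound d0 hb).
    rewrite !ler_norml /profile => /andP[_ h1] /andP[h2 _].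
    have h3 := slide_gap d0 wb.
    have h4 : 0 <= M * (a - d - slide d a).
      by rewrite mulr_ge0// subr_ge0 slide_le.
    have h5 : M * (b - d - slide d b) <= M * (2 * d) by rewrite ler_wpM2l.
    by clear -h1 h2 h4 h5 Md; lra.
  + move=> x xab; rewrite P'; last by case/orP: xab => /eqP ->; exact/dpos/ltW.
    have kx : `|profile' C M d x - m| <= 2 * e by case/orP: xab => /eqP ->.
    split; first exact: le_trans e1.
    rewrite normrM; apply: le_trans ek; rewrite mulrC ler_wpM2r//.
Qed.

(** * The Euclidean structure *)

Section euclid.
Context {R : realType} {n : nat}.
Implicit Types (u w : 'rV[R]_n) (p q : ambient R n) (a : R).

Lemma dotC u w : dot u w = dot w u.
Proof. by apply: eq_bigr => i _; rewrite mulrC. Qed.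

Lemma dotDl u u' w : dot (u + u') w = dot u w + dot u' w.
Proof. by rewrite -big_split; apply: eq_bigr => i _; rewrite mxE mulrDl. Qed.

Lemma dotZl a u w : dot (a *: u) w = a * dot u w.
Proof. by rewrite /dot mulr_sumr; apply: eq_bigr => i _; rewrite mxE mulrA. Qed.

Lemma dotNl u w : dot (- u) w = - dot u w.
Proof. by rewrite -scaleN1r dotZl mulN1r. Qed.

Lemma dotDr u w w' : dot u (w + w') = dot u w + dot u w'.
Proof. by rewrite dotC dotDl !(dotC u). Qed.

Lemma dotZr a u w : dot u (a *: w) = a * dot u w.
Proof. by rewrite dotC dotZl dotC. Qed.

Lemma dotNr u w : dot u (- w) = - dot u w.
Proof. by rewrite dotC dotNl dotC. Qed.

Lemma dot_delta u i : dot u (delta_mx 0 i) = u 0 i.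
Proof.
rewrite /dot (bigD1 i)//= mxE !eqxx mulr1 big1 ?addr0// => j ji.
by rewrite mxE (negPf ji) andbF mulr0.
Qed.

Lemma dot_ge0 u : 0 <= dot u u.
Proof. by rewrite sumr_ge0// => i _; rewrite -expr2 sqr_ge0. Qed.

Lemma sqr_coord_le u i : u 0 i ^+ 2 <= dot u u.
Proof.
rewrite /dot (bigD1 i)//= -expr2 lerDl sumr_ge0// => j _.
by rewrite -expr2 sqr_ge0.
Qed.

Lemma dot_gt0 u i : u 0 i != 0 -> 0 < dot u u.
Proof.
by move=> u0; apply: lt_le_trans (sqr_coord_le u i); rewrite exprn_even_gt0.
Qed.

Lemma dot_eq0 u : (dot u u == 0) = (u == 0).
Proof.
apply/eqP/eqP => [u0|->]; last first.
  by apply: big1 => i _; rewrite mxE mul0r.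
apply/rowP => i; rewrite mxE; apply: contra_eq u0 => /dot_gt0.
by move=> /gt_eqF ->.
Qed.

Lemma enormE u : enorm u ^+ 2 = dot u u.
Proof. by rewrite sqr_sqrtr ?dot_ge0. Qed.

Lemma innerC p q : inner p q = inner q p.
Proof. by rewrite /inner dotC mulrC. Qed.

Lemma innerDl p p' q : inner (p + p') q = inner p q + inner p' q.
Proof. rewrite /inner /= dotDl; ring. Qed.

Lemma innerZl a p q : inner (a *: p) q = a * inner p q.
Proof. rewrite /inner /= dotZl /GRing.scale/=; ring. Qed.

Lemma innerNl p q : inner (- p) q = - inner p q.
Proof. by rewrite -scaleN1r innerZl mulN1r. Qed.

Lemma innerDr p q q' : inner p (q + q') = inner p q + inner p q'.
Proof. by rewrite innerC innerDl !(innerC p). Qed.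

Lemma innerZr a p q : inner p (a *: q) = a * inner p q.
Proof. by rewrite innerC innerZl innerC. Qed.

Lemma innerNr p q : inner p (- q) = - inner p q.
Proof. by rewrite innerC innerNl innerC. Qed.

Lemma inner0l q : inner 0 q = 0.
Proof. by rewrite -(scale0r 0) innerZl mul0r. Qed.

Lemma inner_suml (I : Type) (s : seq I) (f : I -> ambient R n) q :
  inner (\sum_(i <- s) f i) q = \sum_(i <- s) inner (f i) q.
Proof.
by elim: s => [|i s IH]; rewrite ?big_nil ?inner0l// !big_cons innerDl IH.
Qed.

Lemma inner_ge0 p : 0 <= inner p p.
Proof. by rewrite addr_ge0 ?dot_ge0// -expr2 sqr_ge0. Qed.

Lemma fst_coord_linear i : linear (fun p : ambient R n => p.1 0 i : R).
Proof. by move=> a p q; rewrite /= !mxE. Qed.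

Lemma fst_coord_continuous i : continuous (fun p : ambient R n => p.1 0 i : R).
Proof.
move=> p; apply: (@continuous_comp _ _ _ fst (fun u : 'rV[R]_n => u 0 i)).
  exact: cvg_fst.
exact: coord_continuous.
Qed.

End euclid.

Lemma Ck_lin (R : realType) (V W : normedModType R) k (U : set V) (f : V -> W) :
  linear f -> continuous f -> Ck k U f.
Proof.
move=> lf cf.
pose fM := GRing.isLinear.Build _ _ _ _ _ lf.
pose fL : {linear V -> W} := HB.pack f fM.
exact: (@Ck_linear _ _ _ k U fL).
Qed.

Lemma Ck_coord (R : realType) n k (U : set 'rV[R]_n) i :
  Ck k U (fun u : 'rV[R]_n => u 0 i).
Proof.
apply: Ck_lin; last exact: coord_continuous.
by move=> a p q; rewrite /= !mxE.
Qed.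

Lemma Ck_inner (R : realType) n k (U : set (ambient R n)) p q : open U ->
  Ck k U (fun x => inner (x - p) q).
Proof.
move=> oU.
have C1 : Ck k U (fun x : ambient R n => dot x.1 q.1).
  apply: Ck_sum => // i.
  have := Ck_mul oU (Ck_lin k U (@fst_coord_linear _ _ i) (@fst_coord_continuous _ _ i))
    (Ck_cst k U (q.1 0 i)).
  exact: Ck_eq.
have C2 : Ck k U (fun x : ambient R n => x.2 * q.2).
  have C3 : Ck k U (fun x : ambient R n => x.2).
    by apply: Ck_lin => [a x y|x]; [|exact: cvg_snd].
  exact: (Ck_mul oU C3 (Ck_cst k U q.2)).
apply: Ck_eq (Ck_add oU (Ck_add oU C1 C2) (Ck_cst k U (- inner p q))) => //.
by move=> x Ux; rewrite innerDl innerNl.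
Qed.

Lemma Ck_continuous (R : realType) (V W : normedModType R) k (U : set V)
  (f : V -> W) x : Ck k U f -> U x -> {for x, continuous f}.
Proof. by move=> Cf Ux; exact/differentiable_continuous/(Ck_diff Cf Ux). Qed.

Lemma inner_continuous (R : realType) n (p q : ambient R n) :
  continuous (fun x : ambient R n => inner (x - p) q).
Proof. by move=> x; apply: (Ck_continuous (Ck_inner 0 p q openT)). Qed.

Lemma Ck_inner2 (R : realType) n k (U : set (ambient R n)) (p : ambient R n) :
  open U -> Ck k U (fun x : ambient R n => inner (x - p) (x - p)).
Proof.
move=> oU; have C0 q : Ck k U (fun x : ambient R n => inner (x - p) q).
  exact: Ck_inner.
have : Ck k U (fun x : ambient R n => \sum_(i < n)
    (inner (x - p) (delta_mx 0 i, 0) * inner (x - p) (delta_mx 0 i, 0)) +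
    inner (x - p) (0, 1) * inner (x - p) (0, 1)).
  apply: (Ck_add oU); last exact: (Ck_mul oU (C0 _) (C0 _)).
  by apply: (Ck_sum _ oU) => i; exact: (Ck_mul oU (C0 _) (C0 _)).
apply: Ck_eq => // x _.
rewrite /inner /= !mulr1 [dot _ 0]dotC.
rewrite (_ : dot 0 _ = 0) ?add0r; last by rewrite -(scale0r 0) dotZl mul0r.
by congr (_ + _); apply: eq_bigr => i _; rewrite mulr0 addr0 dot_delta.
Qed.

Lemma inner2_continuous (R : realType) n (p : ambient R n) :
  continuous (fun x : ambient R n => inner (x - p) (x - p)).
Proof. by move=> x; apply: (Ck_continuous (Ck_inner2 0 p openT)). Qed.

(** * Inversion, exchanging the half-space and the punctured unit ball *)

Section inversion.
Context {R : realType} {n : nat}.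
Variable i : 'I_n.
Implicit Types (u w : 'rV[R]_n).

Let e : 'rV[R]_n := delta_mx 0 i.

(* The inversion in the sphere of radius sqrt 2 centered at - e. *)
Definition inversion u : 'rV[R]_n :=
  - e + (2 / dot (u + e) (u + e)) *: (u + e).

Lemma dot_pole : dot e e = 1.
Proof. by rewrite dot_delta mxE !eqxx. Qed.

Lemma pole_gt0 u : u != - e -> 0 < dot (u + e) (u + e).
Proof. by move=> ue; rewrite lt_def dot_eq0 dot_ge0 addr_eq0 ue. Qed.

Lemma inversion_dist u : u != - e ->
  dot (inversion u + e) (inversion u + e) = 4 / dot (u + e) (u + e).
Proof.
move=> /pole_gt0 D0; rewrite /inversion addrAC addNr add0r !(dotZl, dotZr).
by field; rewrite gt_eqF.
Qed.

Lemma inversion_neq u : u != - e -> inversion u != - e.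
Proof.
move=> ue; have := pole_gt0 ue; have := inversion_dist ue.
rewrite -addr_eq0 -dot_eq0 => -> D0.
by rewrite mulf_neq0 ?invr_neq0 ?gt_eqF.
Qed.

Lemma inversionK u : u != - e -> inversion (inversion u) = u.
Proof.
move=> ue; rewrite [LHS]/inversion inversion_dist//.
have D0 := pole_gt0 ue.
rewrite {1}/inversion addrAC addNr add0r scalerA.
rewrite (_ : _ * _ = 1); first by rewrite scale1r addrC addrK.
by field; rewrite gt_eqF.
Qed.

(** The defect from 1 has the sign of [u 0 i]: this single identity sends the half-space into the
    ball and its boundary hyperplane into the sphere. *)
Lemma dot_inversion u : u != - e ->
  dot (inversion u) (inversion u) = 1 - 4 * u 0 i / dot (u + e) (u + e).
Proof.
move=> /pole_gt0; have ue : dot (u + e) e = u 0 i + 1.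
  by rewrite dotDl dot_pole dot_delta.
rewrite /inversion; move: (u + e) ue => x xe D0.
rewrite !(dotDl, dotDr, dotZl, dotZr, dotNl, dotNr) dot_pole (dotC e) xe.
by field; rewrite gt_eqF.
Qed.

Lemma inversion_ball u : u != - e ->
  (dot (inversion u) (inversion u) <= 1) = (0 <= u 0 i).
Proof.
move=> ue; rewrite dot_inversion// gerBl.
by rewrite pmulr_lge0 ?invr_gt0 ?pole_gt0// pmulr_rge0.
Qed.

Lemma inversion_sphere u : u != - e ->
  (dot (inversion u) (inversion u) == 1) = (u 0 i == 0).
Proof.
move=> ue; rewrite dot_inversion// -subr_eq0 addrAC subrr add0r oppr_eq0.
by rewrite !mulf_eq0 invr_eq0 pnatr_eq0/= (gt_eqF (pole_gt0 ue)) orbF.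
Qed.

Lemma open_off_pole : open [set u | u != - e].
Proof.
rewrite (_ : [set _ | _] = ~` [set - e]).
  exact/closed_openC/accessible_closed_set1/hausdorff_accessible/norm_hausdorff.
by apply/seteqP; split => u /= /eqP.
Qed.

Lemma half_space_off_pole : half_space i `<=` [set u | u != - e].
Proof.
move=> u /= ui; apply/eqP => ue; move: ui.
by rewrite /half_space/= ue !mxE !eqxx oppr_ge0 ler10.
Qed.

Lemma Ck_inversion_coord k j :
  Ck k [set u | u != - e] (fun u => inversion u 0 j).
Proof.
have oU := open_off_pole.
set U := [set u | _] in oU *.
have C1 l : Ck k U (fun u : 'rV[R]_n => u 0 l + e 0 l).
  exact: (Ck_add oU (Ck_coord k U l) (Ck_cst k U (e 0 l))).
have C2 : Ck k U (fun u => dot (u + e) (u + e)).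
  apply: (Ck_sum _ oU) => l.
  by apply: Ck_eq (Ck_mul oU (C1 l) (C1 l)) => // x _; rewrite !mxE.
have C3 : Ck k U (fun u => (dot (u + e) (u + e))^-1).
  apply: (@Ck_comp _ _ k U [set x | x != 0] GRing.inv) => //; last exact: Ck_inv.
  by move=> u /= /pole_gt0 /gt_eqF ->.
have := Ck_add oU (Ck_cst k U (- e 0 j)) (Ck_mul oU
  (Ck_mul oU (Ck_cst k U (2 : R)) C3) (C1 j)).
by apply: Ck_eq => // u _; rewrite /inversion !mxE.
Qed.

Lemma inversion_differentiable u : u != - e -> differentiable inversion u.
Proof.
move=> ue; have oU := open_off_pole.
have C1 : Ck 0 [set u | u != - e]
    (fun u => \sum_(j <- index_enum 'I_n) inversion u 0 j *: (delta_mx 0 j : 'rV[R]_n)).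
  apply: (@Ck_sum R 'rV[R]_n 'rV[R]_n) => // j.
  by apply: (Ck_scalel _ oU); exact: Ck_inversion_coord.
rewrite (_ : inversion = fun u => \sum_j inversion u 0 j *: delta_mx 0 j).
  exact: (Ck_diff C1 ue).
by apply/funext => w; exact: row_sum_delta.
Qed.

End inversion.

(** * Boundary points of a chart *)

Lemma coord_le_norm (R : realType) n (u : 'rV[R]_n) i : `|u 0 i| <= `|u|.
Proof.
rewrite [leRHS]/Num.norm/= mx_normrE.
exact: (le_bigmax _ (fun x : 'I_1 * 'I_n => `|u x.1 x.2|) (0, i)).
Qed.

Lemma norm_delta_le (R : realType) n (i : 'I_n) :
  `|delta_mx 0 i : 'rV[R]_n| <= 1.
Proof.
rewrite [leLHS]/Num.norm/= mx_normrE; apply/bigmax_leP; split => //= j _.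
by rewrite mxE; case: (_ && _); rewrite /= ?normr1 ?normr0.
Qed.

(** The norm of [A h] attains its minimum on the compact unit sphere, and injectivity makes this
    minimum positive. *)
Lemma linear_bounded_below (R : realType) n (W : normedModType R)
    (A : {linear 'rV[R]_n -> W}) : continuous A -> injective A ->
  exists2 c, 0 < c & forall h, c * `|h| <= `|A h|.
Proof.
move=> cA iA.
(* If the space is zero its unit sphere is empty, and any constant will do. *)
have [[h0 hn0]|H] := pselect (exists h : 'rV[R]_n, h != 0); last first.
  exists 1 => // h; suff -> : h = 0 by rewrite normr0 mulr0.
  by apply: contrapT => hn; apply: H; exists h; apply/eqP.
pose K := [set h : 'rV[R]_n | `|h| = 1].
have cK : compact K.
  apply: bounded_closed_compact.
    by exists 1; split => // x x1 h /= ->; exact: ltW.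
  have := @preimage_closed _ _ (fun h : 'rV[R]_n => `|h|) [set x | x = 1].
  by apply; [move=> h _; exact: norm_continuous|exact: closed_eq].
have K0 : K !=set0.
  exists (`|h0|^-1 *: h0); rewrite /K/= normrZ normfV normr_id mulVf//.
  by rewrite normr_eq0.
have cf : {within K, continuous (fun h => `|A h|)}.
  apply: continuous_subspaceT => h.
  by apply: (@continuous_comp _ _ _ A Num.norm); [exact: cA|exact: norm_continuous].
have [m Km mP] := EVT_min_rV K0 cK cf.
have m1 : `|m| = 1 by move: Km; rewrite inE.
exists `|A m|.
  rewrite normr_gt0; apply/eqP => Am0.
  have m0 : m = 0 by apply: iA; rewrite Am0 linear0.
  by move: m1; rewrite m0 normr0 => /esym/eqP; rewrite oner_eq0.
move=> h; have [->|h0'] := eqVneq h 0; first by rewrite normr0 mulr0.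
have hp : 0 < `|h| by rewrite normr_gt0.
have := mP (`|h|^-1 *: h); rewrite inE/= /K/= linearZ !normrZ normfV normr_id.
by rewrite mulVf ?gt_eqF// => /(_ erefl); rewrite ler_pdivlMl// mulrC.
Qed.

(* Points leaving the hypersurface through [u 0 i = 0] have no preimage in the
   half-space: the i-th coordinate of the preimage would be about - t. *)
Lemma chart_outward (R : realType) n (S U : set (ambient R n)) (i : 'I_n)
    (O : set 'rV[R]_n) (X : 'rV[R]_n -> ambient R n) (u : 'rV[R]_n) :
  chart S i O U X -> O u -> u 0 i = 0 ->
  ~ \forall t \near (0 : R)^'+, S (X u - t *: 'd X u (delta_mx 0 i)).
Proof.
move=> [[oO oU] sX iX XE [Y cY YX]] Ou ui.
have hu : half_space i u by rewrite /half_space/= ui.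
have dX : differentiable X u := sX [::] u Ou.
have [c c0 cP] := linear_bounded_below (diff_continuous dX) (iX u Ou hu).
set e := delta_mx 0 i; set A := 'd X u in cP *; set p := X u => nS.
have SUp : (S `&` U) p by rewrite -XE; exists u.
have cT : (p - t *: A e) @[t --> (0 : R)^'+] --> p.
  apply: cvg_at_right_filter.
  rewrite -[X in _ --> X]subr0 -(scale0r (A e)).
  by apply: cvgB; [exact: cvg_cst|apply: cvgZr_tmp; exact: cvg_id].
have nU : \forall t \near (0 : R)^'+, U (p - t *: A e).
  by have := cT _ (open_nbhs_nbhs (conj oU SUp.2)).
have [d d0 dP] : exists2 d, 0 < d & forall h, `|h| < d ->
    `|X (h + u) - p - A h| <= c / 4 * `|h|.
  have c4 : 0 < c / 4 by rewrite divr_gt0.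
  have /eqaddoP/(_ _ c4)/nbhs_normP[d /= d0 dP] := diff_locally dX.
  exists d => // h hd; have := dP h.
  by rewrite /= sub0r normrN => /(_ hd); rewrite !fctE/= opprD addrA.
(* Continuity of the inverse chart forces the preimage close to [u], where the first-order expansion
   of [X] is available. *)
have nY : \forall q \near p, (S `&` U) q -> `|Y q - u| < d.
  have := (subspace_continuousP (S `&` U) Y).1 cY p SUp.
  rewrite YX// => /cvgr_dist_lt /(_ d d0); rewrite near_withinE.
  by apply: filterS => q H SUq; rewrite distrC; exact: H.
have nYt : \forall t \near (0 : R)^'+, (S `&` U) (p - t *: A e) ->
  `|Y (p - t *: A e) - u| < d.
  by have := cT _ nY.
have [t [[t0 St] [Ut Yt]]] : exists t : R, (0 < t /\ S (p - t *: A e)) /\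
    (U (p - t *: A e) /\ ((S `&` U) (p - t *: A e) -> `|Y (p - t *: A e) - u| < d)).
  have nt : \forall t \near (0 : R)^'+, 0 < t by exact: nbhs_right_gt.
  exact: filter_ex (filterI (filterI nt nS) (filterI nU nYt)).
have SUt : (S `&` U) (p - t *: A e) by [].
have := SUt; rewrite -XE => -[w [Ow hw] Xw].
move: (Yt SUt); rewrite -Xw YX// => wd.
have := dP _ wd; rewrite subrK Xw [p - t *: A e]addrC addrK.
rewrite -opprD normrN -linearZ -linearD.
move Eh : (w - u) wd => h wd Hh.
(* The tolerance [c / 4] is used here. With [|h| <= t + |h| / 4] it gives [|h| <= 4 / 3 * t], so the
   [i]-th coordinate [t + w 0 i] is at most [t / 3], against [w 0 i >= 0]. *)
have H : `|t *: e + h| <= `|h| / 4.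
  by rewrite -(ler_pM2l c0) (le_trans (cP _))// (le_trans Hh)// mulrAC mulrA.
have te : `|t *: e| <= t.
  by rewrite normrZ gtr0_norm//; apply: ler_piMr (ltW t0) (norm_delta_le _ _).
have hn : `|h| <= t + `|h| / 4.
  have := ler_normB (t *: e + h) (t *: e); rewrite [t *: e + h]addrC addrK.
  rewrite [h + _]addrC.
  lra.
have := le_trans (coord_le_norm (t *: e + h) i) H.
have hi : h 0 i = w 0 i by rewrite -Eh !mxE ui subr0.
rewrite !mxE !eqxx mulr1 hi ger0_norm ?addr_ge0 ?(ltW t0)//.
move: hw; rewrite /half_space/= => hw; lra.
Qed.

(** * Velocities *)

(** Curves defining velocities are constrained only for nonnegative times, so the two-sided
    derivative is evaluated as a limit from the right. *)
Lemma right_constant_derive (R : realType) (f : R -> R) (a e : R) : 0 < e ->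
  is_derive (0 : R) 1 f a -> (forall t, 0 <= t < e -> f t = f 0) -> a = 0.
Proof.
move=> e0 [df fa] fe.
have H : h^-1 *: (f (h *: 1 + 0) - f 0) @[h --> (0 : R)^'+] --> a.
  by rewrite -fa; exact: cvg_dnbhs_at_right df.
apply: (cvg_unique (@Rhausdorff R) H); apply: cvg_near_cst; near=> h.
rewrite fe ?subrr ?scaler0// addr0 /GRing.scale/= mulr1; apply/andP; split.
  by apply: ltW; near: h; exact: nbhs_right_gt.
by near: h; exact: nbhs_right_lt.
Unshelve. all: by end_near. Qed.

Lemma is_derive_curve (R : realType) (V W : normedModType R) (g : R -> V)
    (f : V -> W) (t : R) (v : V) (w : W) : is_derive t (1 : R) g v ->
  differentiable f (g t) -> is_derive (g t) v f w -> is_derive t (1 : R) (f \o g) w.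
Proof.
move=> [dg gv] df [_ fw].
have dg' : differentiable g t by exact/derivable1_diffP.
have dfg : differentiable (f \o g) t by exact: differentiable_comp.
apply: DeriveDef; first exact/derivable1_diffP.
have dv : 'd g t 1 = v by rewrite -deriveE.
by rewrite deriveE// diff_comp//= dv -deriveE.
Qed.

Lemma is_derive_inner (R : realType) n (p q x v : ambient R n) :
  is_derive x v (fun x : ambient R n => inner (x - p) q) (inner v q).
Proof.
have H : h^-1 *: (inner (h *: v + x - p) q - inner (x - p) q)
    @[h --> (0 : R)^'] --> inner v q.
  apply: cvg_near_cst; near=> h.
  rewrite -[h *: v + x - p](addrA (h *: v) x (- p)); move: (x - p) => y.
  rewrite innerDl addrK innerZl /GRing.scale/= mulrA mulVf ?mul1r//.
  by near: h; exact: nbhs_dnbhs_neq.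
by apply: DeriveDef; [apply/cvg_ex; eexists; exact: H|exact: cvg_lim H].
Unshelve. all: by end_near. Qed.

Lemma is_derive_inner2 (R : realType) n (p x v : ambient R n) :
  is_derive x v (fun x : ambient R n => inner (x - p) (x - p))
    (2 * inner v (x - p)).
Proof.
have H : h^-1 *: (inner (h *: v + x - p) (h *: v + x - p) -
     inner (x - p) (x - p)) @[h --> (0 : R)^'] --> 2 * inner v (x - p).
  have H1 : 2 * inner v (x - p) + h * inner v v @[h --> (0 : R)^'] -->
      2 * inner v (x - p).
    rewrite -[X in _ --> X]addr0 -[X in _ --> _ + X](mul0r (inner v v)).
    apply: cvgD; first exact: cvg_cst.
    apply: cvgM; last exact: cvg_cst.
    by move=> A /nbhs_dnbhs.
  apply: cvg_trans H1; apply: near_eq_cvg; near=> h.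
  have h0 : h != 0 by near: h; exact: nbhs_dnbhs_neq.
  rewrite -[h *: v + x - p](addrA (h *: v) x (- p)); move: (x - p) => y.
  rewrite !(innerDl, innerDr, innerZl, innerZr) (innerC y) /GRing.scale/=.
  by field.
by apply: DeriveDef; [apply/cvg_ex; eexists; exact: H|exact: cvg_lim H].
Unshelve. all: by end_near. Qed.

Section velocity.
Context {R : realType} {n : nat}.
Implicit Types (A : set (ambient R n)) (p q v w : ambient R n).

Lemma velocity_sub A A' p v : A `<=` A' -> velocity A p v -> velocity A' p v.
Proof.
move=> AA [g [g0 dg [e e0 ge]]]; exists g; split=> //.
by exists e => // t /ge/AA.
Qed.

Lemma tangent_sub A A' p v : A `<=` A' -> tangent A p v -> tangent A' p v.
Proof. by move=> AA [] /(velocity_sub AA) ?; [left|right]. Qed.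

Lemma velocity_plane A p0 v (k : R) p w :
  (forall x, A x -> inner (x - p0) v = k) -> velocity A p w -> inner w v = 0.
Proof.
move=> Ak [g [g0 dg [e e0 ge]]].
have df : differentiable (fun x : ambient R n => inner (x - p0) v) (g 0).
  exact: (Ck_diff (Ck_inner 0 p0 v openT)).
apply: (right_constant_derive e0
  (is_derive_curve dg df (is_derive_inner p0 v (g 0) w))) => t te /=.
by rewrite !Ak//; apply: ge; rewrite ?lexx.
Qed.

Lemma velocity_sphere A p0 (k : R) p w :
  (forall x, A x -> inner (x - p0) (x - p0) = k) -> velocity A p w ->
  inner w (p - p0) = 0.
Proof.
move=> Ak [g [g0 dg [e e0 ge]]].
have df : differentiable (fun x : ambient R n => inner (x - p0) (x - p0)) (g 0).
  exact: (Ck_diff (Ck_inner2 0 p0 openT)).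
have H := is_derive_curve dg df (is_derive_inner2 p0 (g 0) w).
have : 2 * inner w (g 0 - p0) = 0.
  apply: (right_constant_derive e0 H) => t te /=.
  by rewrite !Ak//; apply: ge; rewrite ?lexx.
by rewrite g0 => /eqP; rewrite mulf_eq0 pnatr_eq0/= => /eqP.
Qed.

Lemma tangent_plane A p0 v (k : R) p w :
  (forall x, A x -> inner (x - p0) v = k) -> tangent A p w -> inner w v = 0.
Proof.
move=> Ak [] /(velocity_plane Ak)//.
by rewrite innerNl => /eqP; rewrite oppr_eq0 => /eqP.
Qed.

Lemma tangent_sphere A p0 (k : R) p w :
  (forall x, A x -> inner (x - p0) (x - p0) = k) -> tangent A p w ->
  inner w (p - p0) = 0.
Proof.
move=> Ak [] /(velocity_sphere Ak)//.
by rewrite innerNl => /eqP; rewrite oppr_eq0 => /eqP.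
Qed.

End velocity.

Lemma is_derive_line (R : realType) (V : normedModType R) (u w : V) (t : R) :
  is_derive t (1 : R) (fun t => u + t *: w) w.
Proof.
have H : h^-1 *: (u + (h *: 1 + t) *: w - (u + t *: w)) @[h --> (0 : R)^'] --> w.
  apply: cvg_near_cst; near=> h.
  have h0 : h != 0 by near: h; exact: nbhs_dnbhs_neq.
  rewrite opprD addrACA subrr add0r -scalerBl addrK scalerA [h *: 1]mulr1.
  by rewrite mulVf// scale1r.
by apply: DeriveDef; [apply/cvg_ex; eexists; exact: H|exact: cvg_lim H].
Unshelve. all: by end_near. Qed.

Lemma star_connected (R : realType) (V : normedModType R) (A : set V) (x : V) :
  A x -> (forall y t, A y -> 0 <= t <= 1 -> A (x + t *: (y - x))) ->
  connected A.
Proof.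
move=> Ax Ay; pose L y := (fun t : R => x + t *: (y - x)) @` `[0, 1]%classic.
have -> : A = \bigcup_(y in A) L y.
  apply/seteqP; split => y.
    move=> yA; exists y => //; exists 1; last by rewrite scale1r addrC subrK.
    by rewrite /= in_itv/= ler01 lexx.
  by move=> [z zA [t /=]]; rewrite in_itv/= => t01 <-; exact: Ay.
apply: bigcup_connected.
  exists x => y yA; exists 0; last by rewrite scale0r addr0.
  by rewrite /= in_itv/= ler01 lexx.
move=> y yA; apply: connected_continuous_connected; first exact: segment_connected.
apply: continuous_subspaceT => t.
by apply: cvgD; [exact: cvg_cst|apply: cvgZr_tmp; exact: cvg_id].
Qed.

(** * Planar discs *)

Section disc.
Context {R : realType} {n : nat}.
Variables (p0 v : ambient R n) (b : 'I_n -> ambient R n) (r : R).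
Hypotheses (r0 : 0 < r) (v1 : inner v v = 1).
Hypothesis bb : forall i j, inner (b i) (b j) = (i == j)%:R.
Hypothesis bv : forall i, inner (b i) v = 0.
Hypothesis b_basis : forall p, p = inner p v *: v + \sum_i inner p (b i) *: b i.
Implicit Types (u w : 'rV[R]_n) (p q : ambient R n).

Definition disc : set (ambient R n) :=
  [set p | inner (p - p0) v = 0 /\ Num.sqrt (inner (p - p0) (p - p0)) <= r].

Definition face u : ambient R n := p0 + \sum_i (r * u 0 i) *: b i.

(** Defined on the whole space by orthogonal projection, so that inverse charts are restrictions of
    maps differentiable on open sets. *)
Definition coords p : 'rV[R]_n := \row_i (r^-1 * inner (p - p0) (b i)).

Lemma discE p : disc p <->
  inner (p - p0) v = 0 /\ inner (p - p0) (p - p0) <= r ^+ 2.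
Proof.
rewrite /disc/= -{1}(ger0_norm (ltW r0)) -sqrtr_sqr ler_sqrt//.
by rewrite exprn_ge0// ltW.
Qed.

Lemma face_sub u : face u - p0 = \sum_i (r * u 0 i) *: b i.
Proof. by rewrite /face addrC addKr. Qed.

Lemma face_plane u : inner (face u - p0) v = 0.
Proof.
by rewrite face_sub inner_suml big1// => i _; rewrite innerZl bv mulr0.
Qed.

Lemma inner_face u j : inner (face u - p0) (b j) = r * u 0 j.
Proof.
rewrite face_sub inner_suml (bigD1 j)//= innerZl bb eqxx mulr1 big1 ?addr0//.
by move=> i ij; rewrite innerZl bb (negPf ij) mulr0.
Qed.

Lemma face_dist u : inner (face u - p0) (face u - p0) = r ^+ 2 * dot u u.
Proof.
rewrite {1}face_sub inner_suml /dot mulr_sumr; apply: eq_bigr => i _.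
by rewrite innerZl innerC inner_face; ring.
Qed.

Lemma faceK : cancel face coords.
Proof.
move=> u; apply/rowP => j; rewrite mxE inner_face mulrA mulVf ?mul1r//.
by rewrite gt_eqF.
Qed.

Lemma coordsK p : inner (p - p0) v = 0 -> face (coords p) = p.
Proof.
move=> pv; rewrite /face -[RHS](subrK p0) addrC; congr (_ + _).
rewrite [RHS]b_basis pv scale0r add0r; apply: eq_bigr => i _.
by rewrite mxE mulrA divff ?mul1r// gt_eqF.
Qed.

Lemma disc_face u : disc (face u) <-> dot u u <= 1.
Proof.
rewrite discE face_dist -[leRHS]mulr1 ler_pM2l ?exprn_gt0//.
by split=> [[]//|]; split => //; exact: face_plane.
Qed.

Lemma coords_differentiable p : differentiable coords p.
Proof.
have C1 : Ck 0 setT (fun p => \sum_(j <- index_enum 'I_n)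
    coords p 0 j *: (delta_mx 0 j : 'rV[R]_n)).
  apply: (@Ck_sum R (ambient R n) 'rV[R]_n); first exact: openT.
  move=> j; apply: (Ck_scalel _ openT).
  apply: Ck_eq (Ck_mul openT (Ck_cst 0 setT r^-1) (Ck_inner 0 p0 (b j) openT)).
    exact: openT.
  by move=> x _; rewrite mxE.
rewrite (_ : coords = fun p => \sum_j coords p 0 j *: delta_mx 0 j).
  exact: (Ck_diff C1).
by apply/funext => w; exact: row_sum_delta.
Qed.

(* The charts of the disc: inversions composed with [face], with the pole
   [- e_i] for [s = 1] and [e_i] for [s = - 1] removed. *)
Section chart.
Variables (i : 'I_n) (s : R).
Hypothesis ss : s * s = 1.

Definition disc_chart u := face (s *: inversion i u).

Definition disc_unchart p := inversion i (s *: coords p).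

Definition disc_off_pole : set (ambient R n) :=
  [set p | s *: coords p != - delta_mx 0 i].

Let off : set 'rV[R]_n := [set u | u != - delta_mx 0 i].

Lemma disc_chartK u : off u -> disc_unchart (disc_chart u) = u.
Proof. by move=> ou; rewrite /disc_unchart faceK scalerA ss scale1r inversionK. Qed.

Lemma smooth_disc_chart : smooth_on off disc_chart.
Proof.
apply: CkP => k; have oU := @open_off_pole R n i.
have : Ck k off (fun u => p0 + \sum_(j <- index_enum 'I_n)
    (r * s * inversion i u 0 j) *: b j).
  apply: (Ck_add oU (Ck_cst k _ p0)).
  apply: (Ck_sum _ oU) => j; apply: (Ck_scalel _ oU).
  exact: (Ck_mul oU (Ck_cst k _ (r * s)) (Ck_inversion_coord i k j)).
apply: Ck_eq => // u _; congr (_ + _); apply: eq_bigr => j _.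
by rewrite !mxE mulrA.
Qed.

Lemma scaled_coords_differentiable p : differentiable (fun p => s *: coords p) p.
Proof.
have -> : (fun p => s *: coords p) = s *: coords by [].
exact: differentiableZ (coords_differentiable p).
Qed.

Lemma disc_unchart_differentiable p :
  disc_off_pole p -> differentiable disc_unchart p.
Proof.
move=> op; apply: (@differentiable_comp _ _ _ _ (fun p => s *: coords p)).
  exact: scaled_coords_differentiable.
exact: inversion_differentiable.
Qed.

Lemma disc_chart_off u : off u -> disc_off_pole (disc_chart u).
Proof.
move=> ou; rewrite /disc_off_pole/= faceK scalerA ss scale1r.
exact: inversion_neq.
Qed.

Lemma disc_chartP : chart disc i off disc_off_pole disc_chart.
Proof.
have ds u : dot (s *: u) (s *: u) = dot u u.
  by rewrite dotZl dotZr mulrA ss mul1r.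
split.
- split; first exact: open_off_pole.
  apply: (open_comp _ (@open_off_pole R n i)) => p _.
  exact/differentiable_continuous/scaled_coords_differentiable.
- exact: smooth_disc_chart.
- move=> u ou _.
  have dX : differentiable disc_chart u := smooth_disc_chart [::] ou.
  have dY := disc_unchart_differentiable (disc_chart_off ou).
  (* A differentiable left inverse makes the differential of the chart injective. *)
  have YX h : 'd disc_unchart (disc_chart u) ('d disc_chart u h) = h.
    have dYX : differentiable (disc_unchart \o disc_chart) u.
      exact: differentiable_comp.
    have -> : 'd disc_unchart (disc_chart u) ('d disc_chart u h) =
        'd (disc_unchart \o disc_chart) u h.
      by have /(congr1 (fun f => f h))/= -> := diff_comp dX dY.
    rewrite -deriveE//.
    transitivity ('D_h (id : 'rV[R]_n -> 'rV[R]_n) u); last exact: derive_id.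
    apply: near_eq_derive.
    apply: filterS (open_nbhs_nbhs (conj (@open_off_pole R n i) ou)) => x.
    exact: disc_chartK.
  by move=> h h' hh; rewrite -(YX h) hh YX.
- apply/seteqP; split => p.
    move=> [u [ou hu] <-]; split; last exact: disc_chart_off.
    by apply/disc_face; rewrite ds inversion_ball.
  move=> [/[dup] dp /discE[pv _] op]; exists (disc_unchart p); last first.
    by rewrite /disc_chart inversionK// scalerA ss scale1r coordsK.
  split; first exact: inversion_neq.
  rewrite /half_space/= -inversion_ball; last exact: inversion_neq.
  rewrite inversionK// ds; apply/disc_face; by rewrite coordsK.
- exists disc_unchart; last by move=> u ou _; exact: disc_chartK.
  apply/subspace_continuousP => p [_ op].
  apply: cvg_within_filter.
  exact/differentiable_continuous/disc_unchart_differentiable.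
Qed.

End chart.

(** The two signs remove opposite poles, and no point is both. *)
Lemma disc_chart_exists (i : 'I_n) p : exists2 s : R, s * s = 1 & disc_off_pole i s p.
Proof.
have [E|E] := eqVneq (coords p) (- delta_mx 0 i); last first.
  by exists 1; rewrite ?mulr1// /disc_off_pole/= scale1r.
exists (-1); first by rewrite mulrNN mulr1.
rewrite /disc_off_pole/= E scaleN1r opprK; apply/eqP => /rowP/(_ i).
by rewrite !mxE !eqxx/= => /eqP; rewrite eq_sym eqNr oner_eq0.
Qed.

Lemma hypersurface_disc (i : 'I_n) : hypersurface disc.
Proof.
move=> p dp; have [s ss sp] := disc_chart_exists i p.
exists i, [set u | u != - delta_mx 0 i], (disc_off_pole i s), (disc_chart i s).
by split => //; exact: disc_chartP.
Qed.

Definition disc_rim : set (ambient R n) :=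
  [set p | inner (p - p0) v = 0 /\ inner (p - p0) (p - p0) = r ^+ 2].

Lemma disc_rim_chart (i : 'I_n) (s : R) : s * s = 1 ->
  disc_chart i s @` [set u : 'rV[R]_n | u 0 i = 0] = disc_rim `&` disc_off_pole i s.
Proof.
move=> ss; have ds u : dot (s *: u) (s *: u) = dot u u.
  by rewrite dotZl dotZr mulrA ss mul1r.
apply/seteqP; split => p.
  move=> [u /= ui <-]; have ou : u != - delta_mx 0 i.
    by apply: half_space_off_pole; rewrite /half_space/= ui.
  split; last exact: disc_chart_off.
  split; first exact: face_plane.
  rewrite face_dist ds (_ : dot _ _ = 1) ?mulr1//.
  by apply/eqP; rewrite inversion_sphere// ui.
move=> [[pv pr] sp]; exists (disc_unchart i s p); last first.
  by rewrite /disc_chart inversionK// scalerA ss scale1r coordsK.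
apply/eqP; rewrite -inversion_sphere; last exact: inversion_neq.
have rn : r ^+ 2 != 0 by rewrite gt_eqF// exprn_gt0.
rewrite inversionK// ds.
by apply/eqP/(mulfI rn); rewrite -face_dist coordsK// pr mulr1.
Qed.

Lemma mboundary_disc (i : 'I_n) : mboundary disc = disc_rim.
Proof.
apply/seteqP; split => p; last first.
  move=> rp; have [s ss sp] := disc_chart_exists i p.
  have : (disc_rim `&` disc_off_pole i s) p by [].
  rewrite -disc_rim_chart// => -[u /= ui up].
  exists i, [set u | u != - delta_mx 0 i], (disc_off_pole i s), (disc_chart i s), u.
  split => //; first exact: disc_chartP.
  by apply: half_space_off_pole; rewrite /half_space/= ui.
move=> [j [B [U [X [u [hX Ou uj <-]]]]]].
have [[oO oU] sX iX XE cY] := hX.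
have hu : half_space j u by rewrite /half_space/= uj.
have [du _] : (disc `&` U) (X u) by rewrite -XE; exists u.
move/discE: (du) => [pv pr]; split => //; apply/eqP; rewrite eq_le pr/= leNgt.
(* If [X u] were strictly inside the sphere, a short segment from it in direction [- w] would stay
   in the disc, against [chart_outward]. It stays in the plane because [w] is the velocity of the
   coordinate curve of [X], which lies in the disc for small [t >= 0]. *)
apply/negP => lt_r; apply: (chart_outward hX Ou uj).
set w := 'd X u _.
have wv : inner w v = 0.
  apply: (@velocity_plane _ _ disc p0 v 0 (X u)); first by move=> x [].
  exists (fun t => X (u + t *: delta_mx 0 j)); split.
  - by rewrite scale0r addr0.
  - have dX : differentiable X u := sX [::] u Ou.
    have dc : is_derive (0 : R) (1 : R)
        (fun t : R => u + t *: delta_mx 0 j : 'rV[R]_n) (delta_mx 0 j).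
      exact: is_derive_line.
    have := is_derive_curve dc.
    rewrite /= scale0r addr0 => /(_ _ X); apply => //.
    by apply: DeriveDef; [exact: diff_derivable|rewrite deriveE].
  - have cu : {for (0 : R), continuous (fun t : R => u + t *: delta_mx 0 j : 'rV[R]_n)}.
      by apply: cvgD; [exact: cvg_cst|apply: cvgZr_tmp; exact: cvg_id].
    have nO : \forall t \near (0 : R), B (u + t *: delta_mx 0 j).
      by apply: cu; rewrite scale0r addr0; exact: open_nbhs_nbhs (conj oO Ou).
    have /nbhs_normP[e /= e0 eP] := nO; exists e => // t /andP[t0 te].
    have : (disc `&` U) (X (u + t *: delta_mx 0 j)).
      rewrite -XE; exists (u + t *: delta_mx 0 j) => //; split.
        by apply: eP; rewrite /= sub0r normrN ger0_norm.
      by rewrite /half_space/= !mxE !eqxx mulr1 uj add0r.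
    by case.
have pt t : inner (X u - t *: w - p0) v = 0.
  by rewrite addrAC innerDl innerNl innerZl wv pv mulr0 subr0.
have cN : {for (0 : R), continuous (fun t : R =>
    inner (X u - t *: w - p0) (X u - t *: w - p0))}.
  apply: (@continuous_comp _ _ _ (fun t : R => X u - t *: w)
    (fun x : ambient R n => inner (x - p0) (x - p0))); last exact: inner2_continuous.
  by apply: cvgB; [exact: cvg_cst|apply: cvgZr_tmp; exact: cvg_id].
have nN : \forall t \near (0 : R), inner (X u - t *: w - p0) (X u - t *: w - p0) < r ^+ 2.
  have /= := cN [set x | x < r ^+ 2]; apply.
  by apply: open_nbhs_nbhs; split; [exact: open_lt|rewrite /= scale0r subr0].
apply: cvg_within; apply: filterS nN => t tN; apply/discE; split => //.
exact: ltW.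
Qed.

Lemma connected_disc : connected disc.
Proof.
apply: (@star_connected _ _ _ p0).
  by rewrite discE subrr !inner0l; split => //; rewrite exprn_ge0// ltW.
move=> p t /discE[pv pr] /andP[t0 t1]; apply/discE.
rewrite [p0 + _]addrC addrK !(innerZl, innerZr) pv mulr0; split => //.
apply: le_trans pr; rewrite mulrA ler_piMl ?inner_ge0// -expr2.
by rewrite expr_le1.
Qed.

(** Each chart maps the hyperplane [u 0 i = 0] onto the rim minus a pole. The two pieces share a
    point on a second axis [j], which exists only in dimension at least 2. *)
Lemma connected_disc_rim (i j : 'I_n) : i != j -> connected disc_rim.
Proof.
move=> ij.
have Hs s : s * s = 1 -> connected (disc_rim `&` disc_off_pole i s).
  move=> ss; rewrite -disc_rim_chart//.
  apply: connected_continuous_connected.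
    apply: (@star_connected _ _ _ 0); first by rewrite /= mxE.
    by move=> u t /= ui _; rewrite !mxE ui subr0 mulr0 addr0.
  apply/subspace_continuousP => u /= ui; apply: cvg_within_filter.
  apply/differentiable_continuous/(@smooth_disc_chart i s [::]).
  by apply: half_space_off_pole; rewrite /half_space/= ui.
have -> : disc_rim = (disc_rim `&` disc_off_pole i 1) `|`
    (disc_rim `&` disc_off_pole i (-1)).
  apply/seteqP; split => p; last by case=> -[].
  move=> rp; have [s /eqP ss sp] := disc_chart_exists i p.
  move: ss; rewrite -expr2 sqrf_eq1 => /orP[] /eqP sE; rewrite sE in sp.
    by left.
  by right.
apply: connectedU; [|exact: Hs (mulr1 1)|by apply: Hs; rewrite mulrNN mulr1].
have rj : disc_rim (face (delta_mx 0 j)).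
  split; first exact: face_plane.
  by rewrite face_dist dot_pole mulr1.
have oj s : s * s = 1 -> disc_off_pole i s (face (delta_mx 0 j)).
  move=> ss; rewrite /disc_off_pole/= faceK; apply/eqP => /rowP/(_ i).
  rewrite !mxE !eqxx (negPf ij)/= mulr0 => /eqP.
  by rewrite eq_sym oppr_eq0 oner_eq0.
by exists (face (delta_mx 0 j)); split; split => //; apply: oj;
  rewrite ?mulrNN mulr1.
Qed.

Lemma face_continuous : continuous face.
Proof.
move=> u.
have C1 : Ck 0 setT (fun u => p0 + \sum_(j <- index_enum 'I_n) (r * u 0 j) *: b j).
  apply: (Ck_add openT (Ck_cst 0 _ p0)).
  apply: (Ck_sum _ openT) => j; apply: (Ck_scalel _ openT).
  exact: (Ck_mul openT (Ck_cst 0 _ r) (Ck_coord 0 setT j)).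
exact: (Ck_continuous C1).
Qed.

Lemma compact_disc : compact disc.
Proof.
pose K := [set u : 'rV[R]_n | dot u u <= 1].
have -> : disc = face @` K.
  apply/seteqP; split => p; last by move=> [u uK <-]; apply/disc_face.
  move=> dp; have pf : face (coords p) = p by apply: coordsK; case: dp.
  by exists (coords p) => //; apply/disc_face; rewrite pf.
apply: continuous_compact.
  by apply: continuous_subspaceT => u; exact: face_continuous.
apply: bounded_closed_compact.
  exists 1; split => // x x1 u /= uK.
  rewrite /Num.norm/= mx_normrE; apply/bigmax_leP; split; first lra.
  move=> [k j] _ /=; rewrite ord1; apply: (@le_trans _ _ 1); last exact: ltW.
  rewrite -(@expr_le1 _ 2)// real_normK ?num_real//.
  exact: le_trans (sqr_coord_le _ _) uK.
have C1 : Ck 0 setT (fun u : 'rV[R]_n => dot u u).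
  apply: (Ck_sum _ openT) => j.
  exact: (Ck_mul openT (Ck_coord 0 setT j) (Ck_coord 0 setT j)).
apply: (@preimage_closed _ _ (fun u : 'rV[R]_n => dot u u) [set x | x <= 1]).
  by move=> u _; exact: (Ck_continuous C1).
exact: closed_le.
Qed.

(** The sign is imposed by the contact condition: the outward normal of the sphere will have inner
    product [cos theta] with [v]. *)
Lemma unit_normal_disc (A S : set (ambient R n)) : S `<=` disc ->
  unit_normal S A (cst (- v)).
Proof.
move=> Sd q _; rewrite innerNl innerNr opprK; split => // w /(tangent_sub Sd).
move=> /(@tangent_plane _ _ _ p0 v 0) H.
by rewrite innerNl innerC H ?oppr0// => x [].
Qed.

Lemma minimal_disc : minimal disc.
Proof.
move=> p dp; exists setT, (cst (- v)); split.
- by split => //; exact: openT.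
- by apply: CkP => k; exact: Ck_cst.
- exact: unit_normal_disc.
- move=> e _; rewrite /mean_curvature big1// => i _.
  by rewrite derive_cst inner0l.
Qed.

Lemma two_sided_disc (S : set (ambient R n)) : S `<=` disc -> two_sided S.
Proof.
move=> Sd; exists (cst (- v)); last exact: unit_normal_disc.
move=> p _; exists setT, (cst (- v)); split => //; first exact: openT.
by apply: CkP => k; exact: Ck_cst.
Qed.

End disc.

(** * An explicit orthonormal frame adapted to a tilted hyperplane *)

Section tilted_frame.
Context {R : realType} {n : nat}.
Variables (i0 : 'I_n) (s k : R).
Hypothesis sk : s * s + k * k = 1.
Implicit Types (p q : ambient R n).

Definition tilted_normal : ambient R n := (s *: delta_mx 0 i0, k).

(** The standard basis with only the direction [i0] rotated, in the plane it spans with the axis;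
    this completes the normal without a general orthonormalization. *)
Definition tilted_frame (i : 'I_n) : ambient R n :=
  if i == i0 then (k *: delta_mx 0 i0, - s) else (delta_mx 0 i, 0).

Lemma inner_tilted_normal p : inner p tilted_normal = s * p.1 0 i0 + p.2 * k.
Proof. by rewrite /inner/= dotZr dot_delta. Qed.

Lemma inner_tilted_frame p i : inner p (tilted_frame i) =
  if i == i0 then k * p.1 0 i0 - p.2 * s else p.1 0 i.
Proof.
rewrite /inner /tilted_frame; case: eqP => _ /=.
  by rewrite dotZr dot_delta mulrN.
by rewrite dot_delta mulr0 addr0.
Qed.

Lemma tilted_normal_unit : inner tilted_normal tilted_normal = 1.
Proof. by rewrite inner_tilted_normal/= !mxE !eqxx mulr1. Qed.

Lemma tilted_frame_normal i : inner (tilted_frame i) tilted_normal = 0.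
Proof.
rewrite inner_tilted_normal /tilted_frame; have [_|ii] := eqVneq i i0 => /=.
  by rewrite !mxE !eqxx/=; ring.
by rewrite !mxE eq_sym (negPf ii) andbF mulr0 mul0r addr0.
Qed.

Lemma tilted_frame_orthonormal i j :
  inner (tilted_frame i) (tilted_frame j) = (i == j)%:R.
Proof.
rewrite inner_tilted_frame /tilted_frame.
have [E|ji] := eqVneq j i0; have [E'|ii] := eqVneq i i0; rewrite /= ?mxE.
- by subst; rewrite !eqxx/= mulr1 mulNr opprK addrC sk.
- by subst; rewrite (negPf ii) eq_sym (negPf ii) andbF mulr0 mul0r subr0.
- by subst; rewrite (negPf ji) andbF mulr0 eq_sym (negPf ji).
- by rewrite eqxx/= eq_sym.
Qed.

Lemma tilted_frame_basis p :
  p = inner p tilted_normal *: tilted_normal +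
      \sum_i inner p (tilted_frame i) *: tilted_frame i.
Proof.
rewrite (bigD1 i0)//= [X in _ + (_ + X)](eq_bigr
  (fun i => (p.1 0 i *: delta_mx 0 i, 0) : ambient R n)); last first.
  move=> i ii; rewrite inner_tilted_frame /tilted_frame (negPf ii).
  by congr pair; rewrite /= scaler0.
have -> : \sum_(i | i != i0) ((p.1 0 i *: delta_mx 0 i, 0) : ambient R n) =
    (p.1 - p.1 0 i0 *: delta_mx 0 i0, 0).
  have -> : p.1 - p.1 0 i0 *: delta_mx 0 i0 =
      \sum_(i | i != i0) p.1 0 i *: delta_mx 0 i.
    by rewrite {1}[p.1]row_sum_delta (bigD1 i0)//= addrAC subrr add0r.
  elim/big_rec2 : _ => // i x y ii ->.
  by congr pair; rewrite /= add0r.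
rewrite inner_tilted_normal inner_tilted_frame /tilted_frame eqxx.
case: p => y z; congr pair => /=.
  rewrite !scalerA addrA -scalerDl.
  have -> : (s * y 0 i0 + z * k) * s + (k * y 0 i0 - z * s) * k = y 0 i0.
    by rewrite -[RHS]mulr1 -sk; ring.
  by rewrite addrC subrK.
by rewrite -[LHS]mulr1 -sk /GRing.scale/= addr0; ring.
Qed.

End tilted_frame.

Lemma is_derive_scalel (R : realType) (V : normedModType R) (f : R -> R)
    (t a : R) (w : V) : is_derive t 1 f a ->
  is_derive t (1 : R) (fun t => f t *: w) (a *: w).
Proof.
move=> [df <-]; have df' : differentiable f t by exact/derivable1_diffP.
apply: DeriveDef; first exact/derivable1_diffP/differentiableZl.
by rewrite deriveE; [rewrite diffZl//= -deriveE|exact: differentiableZl].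
Qed.

Lemma components_connected (T : topologicalType) (A : set T) :
  connected A -> A !=set0 -> components A = [set A].
Proof.
move=> cA [x Ax]; apply/seteqP; split => C.
  by move=> [y Ay ->]; exact: connected_component_id.
by move=> ->; exists x => //; rewrite connected_component_id.
Qed.

(** As [G] is connected, only one region can be cut off, so the odd count is 1 exactly when the
    component of [p] is bounded. That component cannot leave [Q], whose trace on [T] is bounded. *)
Lemma region_separated (R : realType) n (T G Q Q' : set (ambient R n)) :
  connected G -> G !=set0 -> open Q -> open Q' ->
  T `\` G `<=` Q `|` Q' -> T `&` Q `&` Q' = set0 -> bounded_set (T `&` Q) ->
  (T `\` G) `&` Q `<=` region T G.
Proof.
move=> cG G0 oQ oQ' TQ QQ bQ p [TGp Qp]; apply: subset_closure.
split; first by case: TGp.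
exists 1%N => //; rewrite components_connected//.
rewrite (_ : [set H | _ /\ _] = [set G]); first exact: card_set1.
apply/seteqP; split => H; first by case.
move=> ->; split => //; split => //.
set K := connected_component _ _.
have cK : connected K by exact: component_connected.
have KT : K `<=` T `\` G by exact: connected_component_sub.
suff KQ : K `&` Q = K.
  apply: sub_boundedr bQ => B TB x; rewrite -KQ => -[/KT[Tx _] Qx].
  exact: TB.
(* The trace of [Q] on [K] is nonempty and open, and also closed, being the complement of the trace
   of [Q']. *)
apply: cK.
- by exists p; split => //; exact: connected_component_refl.
- by exists Q.
- exists (~` Q'); first exact: open_closedC.
  apply/seteqP; split => x [Kx Qx]; split => //.
    move=> Q'x; suff : set0 x by [].
    by rewrite -QQ; split => //; split => //; case: (KT x Kx).
  by have [] := TQ x (KT x Kx).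
Qed.

(** * The tilted disc in a spherical support *)

Section tilted_disc.
Context {R : realType} {n : nat}.
Variables (i0 j0 : 'I_n) (theta d : R) (rho : R -> R).
Hypotheses (ij : i0 != j0) (theta_gt0 : 0 < theta) (theta_ltpi : theta < pi).
Hypotheses (d_gt0 : 0 < d) (cos_d : `|cos theta| + 2 * d < 1).
Hypothesis rho_gt0 : forall z, heights +oo%E z -> 0 < rho z.
Hypothesis rho_sphere : forall z, - d < z < 2 * d ->
  rho z = Num.sqrt (1 - (cos theta + (z - d)) ^+ 2) /\
  derive1 rho z = - (cos theta + (z - d)) / rho z.
Implicit Types (p q : ambient R n).

(** The sine of the tilt; its cosine [k] differs from 1 by at most [s ^+ 2]. *)
Let s := d / 8.
Let k := Num.sqrt (1 - s ^+ 2).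
(** The centre of the sphere, placed so that height [d] is [cos theta] above it. *)
Let c : ambient R n := (0, d - cos theta).
Let v : ambient R n := tilted_normal i0 s k.
Let p0 : ambient R n := c + cos theta *: v.
Let Sigma := disc p0 v (sin theta).
Let Rim := disc_rim p0 v (sin theta).
Let S : set (ambient R n) := S_ +oo%E rho.
Let T : set (ambient R n) := capped +oo%E rho.

Let d_lt1 : d < 1 / 2.
Proof. by move: cos_d; have := normr_ge0 (cos theta); lra. Qed.

Let s_bounds : 0 < s /\ s <= 1 / 16.
Proof. by rewrite /s; move: d_gt0 d_lt1; split; lra. Qed.

Let k_bounds : 1 - s ^+ 2 <= k /\ k <= 1.
Proof.
have [s0 s1] := s_bounds.
have s2 : 0 <= 1 - s ^+ 2 <= 1 by apply/andP; split; nra.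
have /andP[a0 a1] := s2.
have kk : k ^+ 2 = 1 - s ^+ 2 by rewrite sqr_sqrtr.
have k0 : 0 <= k by rewrite sqrtr_ge0.
by split; nra.
Qed.

Let sk : s * s + k * k = 1.
Proof.
have [s0 s1] := s_bounds.
rewrite -!expr2 sqr_sqrtr; [ring|nra].
Qed.

Let vv : inner v v = 1 := tilted_normal_unit i0 sk.

Let sin_gt0 : 0 < sin theta.
Proof. by rewrite sin_gt0_pi// theta_gt0. Qed.

Lemma tilted_plane p : inner (p - p0) v = inner (p - c) v - cos theta.
Proof.
rewrite /p0 opprD addrA; move: (p - c) => y.
by rewrite innerDl innerNl innerZl vv mulr1.
Qed.

Lemma tilted_dist p : inner (p - c) v = cos theta ->
  inner (p - p0) (p - p0) = inner (p - c) (p - c) - cos theta ^+ 2.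
Proof.
rewrite /p0 opprD addrA; move: (p - c) => y yv.
rewrite !(innerDl, innerDr, innerNl, innerNr, innerZl, innerZr) vv.
by rewrite (innerC v) yv; ring.
Qed.

Lemma tilted_discE p : Sigma p <->
  inner (p - c) v = cos theta /\ inner (p - c) (p - c) <= 1.
Proof.
have CS := cos2Dsin2 theta.
rewrite /Sigma discE// tilted_plane; split=> -[/eqP].
  by rewrite subr_eq0 => /eqP H; rewrite tilted_dist// => ?; split => //; lra.
by move=> /eqP H; rewrite tilted_dist// H subrr => ?; split => //; lra.
Qed.

Lemma tilted_rimE p : Rim p <->
  inner (p - c) v = cos theta /\ inner (p - c) (p - c) = 1.
Proof.
have CS := cos2Dsin2 theta.
rewrite /Rim /disc_rim/= tilted_plane; split=> -[/eqP].
  by rewrite subr_eq0 => /eqP H; rewrite tilted_dist// => ?; split => //; lra.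
by move=> /eqP H; rewrite tilted_dist// H subrr => ?; split => //; lra.
Qed.

Lemma inner_center p : inner (p - c) (p - c) =
  dot p.1 p.1 + (cos theta + (p.2 - d)) ^+ 2.
Proof. by rewrite /inner/= subr0 -expr2; congr (_ + _ ^+ 2); ring. Qed.

Lemma height_normal p :
  inner (p - c) v = s * p.1 0 i0 + k * (cos theta + (p.2 - d)).
Proof. by rewrite inner_tilted_normal/= !mxE; ring. Qed.

Lemma horizontal_le p : inner (p - c) (p - c) <= 1 -> `|p.1 0 i0| <= 1.
Proof.
rewrite inner_center => H; rewrite -(@expr_le1 _ 2)// real_normK ?num_real//.
have := sqr_coord_le p.1 i0; have := sqr_ge0 (cos theta + (p.2 - d)); lra.
Qed.

(** The horizontal displacement contributes at most [s = d / 8] and the defect [1 - k] at most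
    [d / 64]. *)
Let tilt_small x : `|x| <= 1 -> `|s * x + k * cos theta - cos theta| <= 9 * d / 64.
Proof.
have [s0 s1] := s_bounds; have [k0 k1] := k_bounds.
move=> x1; have : `|s * x| <= s by rewrite normrM gtr0_norm// ler_piMr// ltW.
have : `|(1 - k) * cos theta| <= s ^+ 2.
  rewrite normrM ger0_norm; last lra.
  apply: (@le_trans _ _ (1 - k)); last lra.
  apply: ler_piMr; first lra.
  by rewrite ler_norml cos_geN1 cos_le1.
have : s ^+ 2 <= d / 64 by rewrite /s; move: d_gt0 d_lt1; nra.
rewrite !ler_norml /s => ? /andP[? ?] /andP[? ?].
by apply/andP; split; lra.
Qed.

(** A vertical offset of [d / 2] counts for at least [63 * d / 128] along [v], more than the error
    [9 * d / 64] of [tilt_small]. *)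
Lemma above_plane p : `|p.1 0 i0| <= 1 -> 3 * d / 2 <= p.2 ->
  cos theta < inner (p - c) v.
Proof.
have [s0 s1] := s_bounds; have [k0 k1] := k_bounds.
move=> /tilt_small; rewrite ler_norml => /andP[h1 h2] pz.
rewrite height_normal.
have : 63 / 64 * (d / 2) <= k * (p.2 - d).
  by apply: ler_pM; move: d_gt0; nra.
move: d_gt0; lra.
Qed.

Lemma below_plane p : `|p.1 0 i0| <= 1 -> p.2 <= d / 2 ->
  inner (p - c) v < cos theta.
Proof.
have [s0 s1] := s_bounds; have [k0 k1] := k_bounds.
move=> /tilt_small; rewrite ler_norml => /andP[h1 h2] pz.
rewrite height_normal.
have : 63 / 64 * (d / 2) <= k * (d - p.2).
  by apply: ler_pM; move: d_gt0; nra.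
move: d_gt0; lra.
Qed.

Lemma plane_slab p : inner (p - c) v = cos theta ->
  inner (p - c) (p - c) <= 1 -> d / 2 < p.2 < 3 * d / 2.
Proof.
move=> pv /horizontal_le px; apply/andP; split; rewrite ltNge; apply/negP.
  by move=> /(below_plane px); rewrite pv ltxx.
by move=> /(above_plane px); rewrite pv ltxx.
Qed.

Lemma rho_sqr z : 0 <= z < 2 * d -> rho z ^+ 2 = 1 - (cos theta + (z - d)) ^+ 2.
Proof.
move=> /andP[z0 z2]; have [|-> _] := rho_sphere (z := z).
  by apply/andP; split; move: d_gt0; lra.
rewrite sqr_sqrtr// subr_ge0 -real_normK ?num_real// expr_le1//.
apply: (le_trans (ler_normD _ _)); apply: ltW; apply: le_lt_trans cos_d.
by rewrite lerD2l ler_norml; apply/andP; split; lra.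
Qed.

Lemma low_M p : 0 <= p.2 < 2 * d ->
  (enorm p.1 <= rho p.2) = (inner (p - c) (p - c) <= 1).
Proof.
move=> /[dup] pz /andP[z0 _].
have r0 : 0 < rho p.2 by apply: rho_gt0; split => //; rewrite ltry.
rewrite inner_center -lerBrDr -rho_sqr// -enormE ler_sqr//.
  by rewrite nnegrE sqrtr_ge0.
by rewrite nnegrE ltW.
Qed.

Lemma low_S p : 0 <= p.2 < 2 * d -> S p <-> inner (p - c) (p - c) = 1.
Proof.
move=> /[dup] pz /andP[z0 _].
have hz : heights +oo%E p.2 by split => //; rewrite ltry.
have r0 := rho_gt0 hz.
rewrite inner_center; split.
  move=> [_ [w w1 ->]]; rewrite dotZl dotZr -enormE w1 expr1n mulr1 -expr2.
  by rewrite rho_sqr// subrK.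
move=> H; have E : dot p.1 p.1 = rho p.2 ^+ 2 by rewrite rho_sqr//; lra.
split => //; exists ((rho p.2)^-1 *: p.1).
  rewrite /enorm dotZl dotZr E (_ : _ * _ = 1) ?sqrtr1//.
  by field; rewrite gt_eqF.
by rewrite scalerA divff ?scale1r// gt_eqF.
Qed.

(** On a unit sphere the outward normal is the radius vector: here [1 + rho' ^ 2 = 1 / rho ^ 2]. *)
Lemma N_sphere p : 0 < p.2 < 2 * d -> N_ rho p = p - c.
Proof.
move=> /andP[z0 z2].
have hz : heights +oo%E p.2 by split; [exact: ltW|rewrite ltry].
have r0 := rho_gt0 hz.
have [|_ dr] := rho_sphere (z := p.2).
  by apply/andP; split; move: d_gt0; lra.
have r2 := @rho_sqr p.2; rewrite ltW// z2 in r2; have {}r2 := r2 isT.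
have E : Num.sqrt (1 + derive1 rho p.2 ^+ 2) = (rho p.2)^-1.
  have -> : 1 + derive1 rho p.2 ^+ 2 = (rho p.2)^-1 ^+ 2.
    have -> : derive1 rho p.2 ^+ 2 = (1 - rho p.2 ^+ 2) / rho p.2 ^+ 2.
      by rewrite r2 dr exprMn sqrrN exprVn r2; congr (_ / _); ring.
    by field; rewrite gt_eqF.
  by rewrite sqrtr_sqr ger0_norm// invr_ge0 ltW.
rewrite /N_ E invrK dr; case: p {hz E r2} r0 z0 z2 dr => y z /= r0 z0 z2 dr.
congr pair; first by rewrite scalerA divff ?scale1r ?subr0// gt_eqF.
by rewrite /GRing.scale/=; field; rewrite gt_eqF.
Qed.

Lemma capped_low p : T p -> p.2 < 2 * d ->
  0 <= p.2 /\ inner (p - c) (p - c) <= 1.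
Proof.
move=> [[pz pD] p2|Sp p2].
  have p0d : 0 <= p.2 < 2 * d by rewrite pz lexx/= mulr_gt0.
  by rewrite -low_M// pz.
have z0 : 0 <= p.2 by case: Sp => -[].
by split => //; rewrite ((low_S _).1 Sp)// z0.
Qed.

(** [Low] is cut at [2 * d] to be bounded on the support, and [High] takes all points above
    [3 * d / 2]. They are disjoint on the support, since between these two heights it lies above the
    plane. *)
Let Low : set (ambient R n) :=
  [set p | p.2 < 2 * d /\ inner (p - c) v < cos theta].

Let High : set (ambient R n) :=
  [set p | 3 * d / 2 < p.2 \/ cos theta < inner (p - c) v].

Let normal_continuous : continuous (fun p : ambient R n => inner (p - c) v).
Proof. exact: inner_continuous. Qed.

Let height_continuous : continuous (fun p : ambient R n => p.2).
Proof. by move=> p; exact: cvg_snd. Qed.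

Let open_Low : open Low.
Proof.
apply: openI.
  apply: (@open_comp _ _ (fun p : ambient R n => p.2) [set x | x < 2 * d]).
    by move=> q _; exact: height_continuous.
  exact: open_lt.
apply: (@open_comp _ _ (fun p : ambient R n => inner (p - c) v) [set x | x < cos theta]).
  by move=> q _; exact: normal_continuous.
exact: open_lt.
Qed.

Let open_High : open High.
Proof.
apply: openU.
  apply: (@open_comp _ _ (fun p : ambient R n => p.2) [set x | 3 * d / 2 < x]).
    by move=> q _; exact: height_continuous.
  exact: open_gt.
apply: (@open_comp _ _ (fun p : ambient R n => inner (p - c) v) [set x | cos theta < x]).
  by move=> q _; exact: normal_continuous.
exact: open_gt.
Qed.

Let frame_orthonormal := tilted_frame_orthonormal i0 sk.
Let frame_normal := @tilted_frame_normal R n i0 s k.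
Let frame_basis := tilted_frame_basis i0 sk.

Lemma mboundary_tilted_disc : mboundary Sigma = Rim.
Proof.
exact: (mboundary_disc p0 sin_gt0 frame_orthonormal frame_normal frame_basis i0).
Qed.

Lemma connected_tilted_rim : connected Rim.
Proof.
exact: (connected_disc_rim sin_gt0 frame_orthonormal frame_normal frame_basis ij).
Qed.

Lemma tilted_rim_neq0 : Rim !=set0.
Proof.
exists (face p0 (tilted_frame i0 s k) (sin theta) (delta_mx 0 i0)); split.
  exact: face_plane.
by rewrite face_dist// dot_pole mulr1.
Qed.

Lemma tilted_rim_slab p : Rim p -> d / 2 < p.2 < 3 * d / 2.
Proof. by move=> /tilted_rimE[pv pc]; apply: plane_slab => //; rewrite pc. Qed.

Lemma region_below p : T p -> p.2 < 2 * d -> inner (p - c) v < cos theta ->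
  region T Rim p.
Proof.
move=> Tp pz pv; apply: (region_separated connected_tilted_rim tilted_rim_neq0 open_Low open_High).
- move=> q [Tq nRq].
  have [qz|qz] := leP (2 * d) q.2; first by right; left; move: d_gt0; lra.
  have [q0 qc] := capped_low Tq qz.
  have [qv|qv|qv] := ltgtP (inner (q - c) v) (cos theta).
  + by left.
  + by right; right.
  (* A point of the plane in [T] at such a height is on the rim: it lies in the slab, hence not on
     the cap at height 0. *)
  exfalso; apply: nRq; apply/tilted_rimE; split => //.
  have /andP[h1 h2] := plane_slab qv qc.
  apply/low_S; first by rewrite q0.
  by case: Tq => // -[qz0 _]; move: h1 d_gt0; rewrite qz0; lra.
- rewrite -subset0 => q [[Tq [qz qv]] [qz'|]]; last by rewrite lt_gtF.
  have [q0 qc] := capped_low Tq qz.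
  by have := above_plane (horizontal_le qc) (ltW qz'); rewrite lt_gtF.
- exists 1; split => // M M1 q [Tq [qz qv]].
  have [q0 qc] := capped_low Tq qz.
  rewrite /= prod_normE/= ge_max; apply/andP; split; apply: (le_trans _ (ltW M1)).
    rewrite /Num.norm/= mx_normrE; apply/bigmax_leP; split; first lra.
    move=> [l j] _ /=; rewrite ord1 -(@expr_le1 _ 2)// real_normK ?num_real//.
    move: qc; rewrite inner_center; have := sqr_coord_le q.1 j.
    by have := sqr_ge0 (cos theta + (q.2 - d)); lra.
  by rewrite ger0_norm//; move: d_lt1; lra.
- split; last by [].
  by split => // /tilted_rimE[]; move: pv => /[swap] -> ; rewrite ltxx.
Qed.

Lemma D0_region : D_ rho 0 `<=` region T Rim.
Proof.
move=> p Dp; have Tp : T p by left.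
have pz : p.2 = 0 by case: Dp.
have p2 : p.2 < 2 * d by rewrite pz mulr_gt0.
have [_ pc] := capped_low Tp p2.
apply: region_below => //; apply: below_plane (horizontal_le pc) _.
by rewrite pz divr_ge0// ltW.
Qed.

(** The solution [mu] of [- v = - cos theta *: (p - c) + sin theta *: mu]. *)
Definition contact_conormal p : ambient R n :=
  (sin theta)^-1 *: (- v + cos theta *: (p - c)).

Section great_circle.
Variable p : ambient R n.
Hypothesis Rp : Rim p.

Let m := contact_conormal p.

Let pcv : inner (p - c) v = cos theta. Proof. by case: (tilted_rimE p).1. Qed.
Let pcc : inner (p - c) (p - c) = 1. Proof. by case: (tilted_rimE p).1. Qed.

Lemma conormal_unit : inner m m = 1.
Proof.
have CS := cos2Dsin2 theta.
rewrite /m /contact_conormal; move: (p - c) pcv pcc => y yv yy.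
rewrite !(innerZl, innerZr) !(innerDl, innerDr, innerNl, innerNr, innerZl, innerZr).
rewrite vv (innerC v) yv yy.
rewrite [X in _ * (_ * X)](_ : _ = sin theta ^+ 2); last first.
  rewrite (_ : sin theta ^+ 2 = 1 - cos theta ^+ 2); first ring.
  by rewrite -CS addrAC subrr add0r.
by field; rewrite gt_eqF.
Qed.

Lemma conormal_radius : inner m (p - c) = 0.
Proof.
rewrite /m /contact_conormal; move: (p - c) pcv pcc => y yv yy.
by rewrite innerZl innerDl innerNl innerZl (innerC v) yv yy mulr1 addNr mulr0.
Qed.

Lemma conormal_normal : inner m v = - sin theta.
Proof.
have CS := cos2Dsin2 theta.
rewrite /m /contact_conormal; move: (p - c) pcv => y yv.
rewrite innerZl innerDl innerNl innerZl yv vv.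
rewrite (_ : - 1 + _ = - (sin theta) ^+ 2); last by rewrite -CS; ring.
by field; rewrite gt_eqF.
Qed.

(** A curve on the sphere with velocity the conormal, serving both as witness of tangency to the
    support and as witness of pointing into the region. *)
Definition great_circle (t : R) : ambient R n := c + (cos t *: (p - c) + sin t *: m).

Lemma great_circle0 : great_circle 0 = p.
Proof.
by rewrite /great_circle cos0 sin0 scale1r scale0r addr0 addrC subrK.
Qed.

Lemma great_circle_sphere t : inner (great_circle t - c) (great_circle t - c) = 1.
Proof.
have H (y w : ambient R n) : inner y y = 1 -> inner w w = 1 -> inner w y = 0 ->
    inner (cos t *: y + sin t *: w) (cos t *: y + sin t *: w) = 1.
  move=> yy ww wy; rewrite -(cos2Dsin2 t).
  rewrite !(innerDl, innerDr, innerZl, innerZr) (innerC y) yy ww wy; ring.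
rewrite /great_circle [c + _]addrC addrK.
by apply: H; [exact: pcc|exact: conormal_unit|exact: conormal_radius].
Qed.

Lemma great_circle_normal t : inner (great_circle t - c) v = cos (t + theta).
Proof.
have H (y w : ambient R n) : inner y v = cos theta ->
    inner w v = - sin theta -> inner (cos t *: y + sin t *: w) v = cos (t + theta).
  by move=> yv wv; rewrite innerDl !innerZl yv wv cosD; ring.
rewrite /great_circle [c + _]addrC addrK.
by apply: H; [exact: pcv|exact: conormal_normal].
Qed.

Lemma is_derive_great_circle : is_derive (0 : R) (1 : R) great_circle m.
Proof.
have d1 := is_derive_scalel (p - c) (is_derive_cos (0 : R)).
have d2 := is_derive_scalel m (is_derive_sin (0 : R)).
have d3 := is_deriveD (is_derive_cst c (0 : R) 1) (is_deriveD d1 d2).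
by apply: is_derive_eq d3 _; rewrite sin0 oppr0 scale0r cos0 scale1r !add0r.
Qed.

Lemma great_circle_continuous : {for (0 : R), continuous great_circle}.
Proof.
by apply/differentiable_continuous/derivable1_diffP; case: is_derive_great_circle.
Qed.

Lemma near_great_circle : \forall t \near (0 : R), 0 < (great_circle t).2 < 2 * d.
Proof.
have /andP[z0 z1] := tilted_rim_slab Rp.
have cz : (great_circle t).2 @[t --> (0 : R)] --> (great_circle 0).2.
  apply: (@continuous_comp _ _ _ great_circle (fun q : ambient R n => q.2)).
    exact: great_circle_continuous.
  exact: height_continuous.
rewrite great_circle0 in cz.
have lz := cz [set x | 0 < x]; have gz := cz [set x | x < 2 * d].
have A : \forall t \near (0 : R), 0 < (great_circle t).2.
  apply: lz; apply: open_nbhs_nbhs; split; first exact: open_gt.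
  by rewrite /=; move: d_gt0; lra.
have B : \forall t \near (0 : R), (great_circle t).2 < 2 * d.
  apply: gz; apply: open_nbhs_nbhs; split; first exact: open_lt.
  by rewrite /=; move: d_gt0; lra.
by apply: filterS2 A B => t -> ->.
Qed.

Lemma great_circle_S : \forall t \near (0 : R), S (great_circle t).
Proof.
apply: filterS near_great_circle => t /andP[t0 t2].
by apply/low_S; [rewrite ltW|exact: great_circle_sphere].
Qed.

Lemma great_circle_region : exists2 e : R, 0 < e &
  forall t, 0 <= t < e -> region T Rim (great_circle t).
Proof.
have /nbhs_normP[e0 /= e00 nz] := near_great_circle.
have /nbhs_normP[e1 /= e10 nS] := great_circle_S.
(* The bound [pi - theta] keeps [t + theta] in the interval where [cos] is strictly decreasing. *)
pose e := Num.min (Num.min e0 e1) (pi - theta).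
have e_gt0 : 0 < e by rewrite !lt_min e00 e10 subr_gt0.
have H t : 0 < t < e -> region T Rim (great_circle t).
  move=> /andP[t0]; rewrite !lt_min => /andP[/andP[te0 te1] tpi].
  have tn : `|0 - t| = t by rewrite sub0r normrN gtr0_norm.
  apply: region_below.
  - by right; apply: nS; rewrite /= tn.
  - by have := nz t; rewrite /= tn => /(_ te0)/andP[].
  - rewrite great_circle_normal ltr_cos.
    + by rewrite ltrDr.
    + by rewrite in_itv/= (ltW theta_gt0) (ltW theta_ltpi).
    + by rewrite in_itv/=; move: theta_gt0 tpi; lra.
(* At [t = 0] the point is on the rim itself and belongs to the region only as a limit of the points
   with [t > 0]. *)
exists e => // t /andP[]; rewrite le_eqVlt => /predU1P[<- _|t0 te]; last first.
  by apply: H; rewrite t0.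
have cl : closed (region T Rim) by exact: closed_closure.
apply: (@closed_cvg _ _ (0 : R)^'+ _ great_circle _ cl); last first.
  exact/cvg_at_right_filter/great_circle_continuous.
near=> u; apply: H; apply/andP; split.
  by near: u; exact: nbhs_right_gt.
by near: u; exact: nbhs_right_lt.
Unshelve. all: by end_near. Qed.

Lemma inner_conormal_contact : inner_conormal S Rim (region T Rim) p m.
Proof.
split.
- exact: conormal_unit.
- left; exists great_circle; split; first exact: great_circle0.
    exact: is_derive_great_circle.
  have /nbhs_normP[e /= e0 nS] := great_circle_S; exists e => // t /andP[t0 te].
  by apply: nS; rewrite /= sub0r normrN ger0_norm.
- move=> w tw; have wv : inner w v = 0.
    by apply: (tangent_plane (k := cos theta) (p0 := c) _ tw) => x /tilted_rimE[].
  have wp : inner w (p - c) = 0.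
    by apply: (tangent_sphere (k := 1) _ tw) => x /tilted_rimE[].
  rewrite /m /contact_conormal innerC; move: (p - c) wp => y wy.
  by rewrite innerZr innerDr innerNr innerZr wv wy oppr0 mulr0 addr0 mulr0.
- exists great_circle; split; first exact: great_circle0.
    exact: is_derive_great_circle.
  exact: great_circle_region.
Qed.

End great_circle.

Lemma tilted_disc_capillary : minimal_capillary +oo%E rho theta Sigma.
Proof.
have cS : components Sigma = [set Sigma].
  apply: components_connected; first exact: (connected_disc sin_gt0).
  have [p /tilted_rimE[pv pc]] := tilted_rim_neq0; exists p; apply/tilted_discE.
  by rewrite pc lexx.
split.
- exact: (compact_disc sin_gt0 frame_orthonormal frame_normal frame_basis).
- exact: (hypersurface_disc sin_gt0 frame_orthonormal frame_normal frame_basis i0).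
- move=> p /tilted_discE[pv pc]; apply: subset_closure.
  have /andP[z0 z2] := plane_slab pv pc.
  have pz : 0 <= p.2 < 2 * d by apply/andP; split; move: d_gt0; lra.
  split; first by split; [move: d_gt0; lra|exact: ltry].
  by rewrite low_M.
- exact: (minimal_disc vv).
- by move=> A; rewrite cS => ->; exact: (@two_sided_disc _ _ p0 _ (sin theta) vv).
- rewrite mboundary_tilted_disc => p [/tilted_discE[pv pc] nRp].
  have {}pc : inner (p - c) (p - c) < 1.
    by rewrite lt_neqAle pc andbT; apply/eqP => E; apply: nRp; apply/tilted_rimE.
  have /andP[z0 z2] := plane_slab pv (ltW pc).
  have n1 : \forall q \near p, inner (q - c) (q - c) < 1.
    have /= := @inner2_continuous R n c p [set x | x < 1]; apply.
    by apply: open_nbhs_nbhs; split; first exact: open_lt.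
  have n2 : \forall q \near p, 0 < q.2.
    have /= := @height_continuous p [set x | 0 < x]; apply.
    apply: open_nbhs_nbhs; split; first exact: open_gt.
    by rewrite /=; move: d_gt0; lra.
  have n3 : \forall q \near p, q.2 < 2 * d.
    have /= := @height_continuous p [set x | x < 2 * d]; apply.
    apply: open_nbhs_nbhs; split; first exact: open_lt.
    by rewrite /=; move: d_gt0; lra.
  rewrite /interior/=; apply: filterS3 n1 n2 n3 => q q1 q2 q3.
  split; first by split; [exact: ltW|rewrite ltry].
  by rewrite low_M ?ltW// q3 ltW.
- by rewrite mboundary_tilted_disc; exact: tilted_rim_neq0.
- rewrite mboundary_tilted_disc => p /[dup] Rp /tilted_rim_slab/andP[z0 z2].
  have pz : 0 <= p.2 < 2 * d by apply/andP; split; move: d_gt0; lra.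
  split; first by apply/low_S => //; case: (tilted_rimE p).1.
  by move=> [p2 _]; move: z0 d_gt0; rewrite p2; lra.
- move=> A; rewrite cS => ->; exists (cst (- v)); split.
  + move=> p _; exists setT, (cst (- v)); split => //; first exact: openT.
    by apply: CkP => l; exact: Ck_cst.
  + exact: (@unit_normal_disc _ _ p0 _ (sin theta) vv).
  rewrite mboundary_tilted_disc => p Rp.
  have /andP[z0 z2] := tilted_rim_slab Rp.
  have pz : 0 < p.2 < 2 * d by apply/andP; split; move: d_gt0; lra.
  have [pv pc] := (tilted_rimE p).1 Rp.
  rewrite N_sphere//; split; first by rewrite innerNl innerC pv.
  exists (contact_conormal p); first exact: inner_conormal_contact.
  rewrite /contact_conormal scalerA divff ?gt_eqF// scale1r scaleNr.
  by rewrite addrCA addNr addr0.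
Qed.

Lemma tilted_disc_nonhorizontal : nonhorizontal_planar_ball Sigma.
Proof.
exists p0, v, (sin theta); split => //.
have [s0 _] := s_bounds; apply/eqP => /rowP/(_ i0).
by rewrite !mxE !eqxx mulr1 => s00; move: s0; rewrite s00 ltxx.
Qed.

Lemma D0_region_tilted :
  D_ rho 0 `<=` region (capped +oo%E rho) (mboundary Sigma).
Proof. by rewrite mboundary_tilted_disc; exact: D0_region. Qed.

End tilted_disc.


Theorem theorem2p4 (R : realType) (n : nat) (theta : R)
    (hn : (2 <= n)%N) (htheta : 0 < theta < pi) :
  exists (L : \bar R) (rho : R -> R) (Sigma : set (ambient R n)),
    [/\ rotational_support L rho /\ no_cylindrical_interval L rho,
        minimal_capillary L rho theta Sigma,
        D_ rho 0 `<=` region (capped L rho) (mboundary Sigma),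
        ~ slope_condition L rho theta /\ nonhorizontal_planar_ball Sigma &
        theta != pi / 2 ->
          forall a b : R, 0 < a -> a < b -> (b%:E < ell L rho theta)%E ->
            A_ n rho theta b < B_ n rho theta a].
Proof.
have [d [rho [[d0 dC] [rs ncyl] circ nsc AB]]] := meridian_exists n htheta.
have /andP[th0 thpi] := htheta.
(* [i0] is the direction of the tilt; [j0] is the second axis which makes the rim connected. *)
pose i0 : 'I_n := Ordinal (ltnW hn); pose j0 : 'I_n := Ordinal hn.
have ij : i0 != j0 by [].
have rp := support_pos rs.
eexists +oo%E, rho, _; split.
- by split.
- exact: (tilted_disc_capillary ij th0 thpi d0 dC rp circ).
- exact: (D0_region_tilted ij th0 thpi d0 dC rp circ).
- split=> //; exact: (tilted_disc_nonhorizontal i0 th0 thpi d0 dC).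
- exact: AB.
Qed.
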